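(* Consider the decentralized stochastic problem and the NET-FLEET iterates described in the context, and suppose Assumption A of the context holds (with constants $L>0$, $\sigma>0$). Then there exist constants $c>0$ and $C>0$ depending only on $L$ and on $\lambda=\max\{|\lambda_2(\mathbf W)|,|\lambda_m(\mathbf W)|\}$ (not on $m,S,K,\sigma$) such that, whenever $K=S^{1/3}/m$ is a positive integer, $SK\ge m^{1/3}$, and the step-size is $\eta=c\sqrt{m/(SK)}$, the NET-FLEET iterates satisfy $$\frac{1}{SK}\sum_{s=0}^{S-1}\sum_{k=0}^{K-1}\mathbb E\Big[\|\nabla f(\bar{\mathbf x}_{s,k})\|^2+\frac{L^2}{m}\sum_{i=1}^m\|\mathbf x_{s,k}^{(i)}-\bar{\mathbf x}_{s,k}\|^2\Big]\le C\Big(\frac{\mathbb E[\mathfrak P_{0,0}-\mathfrak P_{S,0}]}{\sqrt{SKm}}+\frac{\sigma^2}{\sqrt{SKm}}\Big),$$ where $$\mathfrak P_{s,k}= f(\bar{\mathbf x}_{s,k})+\frac{1}{m^2K}\sum_{i=1}^m\Big(\|\mathbf x_{s,k}^{(i)}-\bar{\mathbf x}_{s,k}\|^2+C_1\eta^2\|\mathbf y_{s,k}^{(i)}-\bar{\mathbf y}_{s,k}\|^2\Big),\qquad C_1=\frac{6(1+\lambda K-\lambda)K}{(1-\lambda)^2}.$$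
   Context: Problem: $m$ workers form an undirected connected graph $\mathcal G=(\mathcal N,\mathcal L)$, $|\mathcal N|=m$. Worker $i$ has a data distribution $\mathcal D_i$ (possibly different for different $i$) and a loss $f_i(\mathbf x)=\mathbb E_{\zeta\sim\mathcal D_i}[f_i(\mathbf x;\zeta)]$, $\mathbf x\in\mathbb R^p$, not necessarily convex. The global objective is $f(\mathbf x)=\frac1m\sum_{i=1}^m f_i(\mathbf x)$. All norms are Euclidean. Assumption A. (1) There is $\mathbf x^*\in\mathbb R^p$ with $f(\mathbf x)\ge f(\mathbf x^* )$ for all $\mathbf x$. (2) Each $f_i$ is continuously differentiable and $\|\nabla f_i(\mathbf x_1)-\nabla f_i(\mathbf x_2)\|\le L\|\mathbf x_1-\mathbf x_2\|$ for all $\mathbf x_1,\mathbf x_2\in\mathbb R^p$, for a constant $L>0$. (3) For each $i$ and $\mathbf x$, $\mathbb E_{\zeta\sim\mathcal D_i}[\nabla f_i(\mathbf x;\zeta)]=\nabla f_i(\mathbf x)$ and $\mathbb E_{\zeta\sim\mathcal D_i}\|\nabla f_i(\mathbf x;\zeta)-\nabla f_i(\mathbf x)\|^2\le\sigma^2$, for a constant $\sigma>0$. Consensus matrix: $\mathbf W\in\mathbb R^{m\times m}$ is symmetric and doubly stochastic, and for $i\ne j$, $[\mathbf W]_{ij}>0$ if $(i,j)\in\mathcal L$ and $[\mathbf W]_{ij}=0$ otherwise. Its eigenvalues satisfy $-1<\lambda_m(\mathbf W)\le\dots\le\lambda_2(\mathbf W)<\lambda_1(\mathbf W)=1$, so $\lambda=\max\{|\lambda_2(\mathbf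 W)|,|\lambda_m(\mathbf W)|\}<1$. NET-FLEET algorithm (initial point $\mathbf x^0\in\mathbb R^p$, step-size $\eta$, communication rounds $S$, local rounds $K$). Throughout $\mathbf g_{s,k}^{(i)}=\nabla f_i(\mathbf x_{s,k}^{(i)};\zeta_{s,k}^{(i)})$ denotes the stochastic gradient. Every sample drawn by worker $i$ (namely $\zeta_{0,0}^{(i)}$ and $\zeta_{s,k}^{(i)}$ with $1\le k\le K$) has law $\mathcal D_i$; samples are independent across workers and independent of all previously drawn samples. Initialize $\mathbf x_{0,0}^{(i)}=\mathbf x^0$, $\mathbf y_{0,0}^{(i)}=\mathbf g_{0,0}^{(i)}$ for all $i$. For $s=0,\dots,S-1$ and every worker $i$: - $\mathbf x_{s,1}^{(i)}=\sum_{j=1}^m[\mathbf W]_{ij}\mathbf x_{s,0}^{(j)}-\eta\mathbf y_{s,0}^{(i)}$, then $\mathbf y_{s,1}^{(i)}=\sum_{j=1}^m[\mathbf W]_{ij}\mathbf y_{s,0}^{(j)}+\mathbf g_{s,1}^{(i)}-\mathbf g_{s,0}^{(i)}$; - for $k=1,\dots,K-1$: $\mathbf x_{s,k+1}^{(i)}=\mathbf x_{s,k}^{(i)}-\eta\mathbf y_{s,k}^{(i)}$, then $\mathbf y_{s,k+1}^{(i)}=\mathbf y_{s,k}^{(i)}+\mathbf g_{s,k+1}^{(i)}-\mathbf g_{s,k}^{(i)}$; - set $\mathbf x_{s+1,0}^{(i)}=\mathbf x_{s,K}^{(i)}$, $\mathbf y_{s+1,0}^{(i)}=\mathbf y_{s,K}^{(i)}$,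 $\mathbf g_{s+1,0}^{(i)}=\mathbf g_{s,K}^{(i)}$ (no new sample is drawn). Averages: $\bar{\mathbf x}_{s,k}=\frac1m\sum_i\mathbf x_{s,k}^{(i)}$, $\bar{\mathbf y}_{s,k}=\frac1m\sum_i\mathbf y_{s,k}^{(i)}$. $\mathbb E$ is expectation over all drawn samples. *)

(* Defs.v *)
From HB Require Import structures.
From mathcomp Require Import all_boot all_order all_algebra.
From mathcomp Require Import finmap.
From mathcomp Require Import all_classical all_reals all_analysis.

Set Implicit Arguments.
Unset Strict Implicit.
Unset Printing Implicit Defensive.

Import Order.TTheory GRing.Theory Num.Theory.
Import numFieldNormedType.Exports.

Local Open Scope classical_set_scope.
Local Open Scope ring_scope.

(* The library norm on 'rV[R]_p is the sup norm, hence this definition. *)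
Definition enorm (R : realType) (p : nat) (v : 'rV[R]_p) : R :=
  Num.sqrt (\sum_(j < p) v 0 j ^+ 2).

Definition grad (R : realType) (p : nat) (f : 'rV[R]_p -> R) (x : 'rV[R]_p)
    : 'rV[R]_p :=
  \row_(j < p) 'D_(delta_mx 0 j) (f : 'rV[R]_p -> R^o) x.

Definition avg (R : realType) (V : lmodType R) (m : nat) (v : 'I_m -> V) : V :=
  m%:R^-1 *: \sum_(i < m) v i.

Record connected_graph (m : nat) (e : rel 'I_m) : Prop := {
  graph_sym : symmetric e;
  graph_irrefl : irreflexive e;
  graph_connected : forall i j, connect e i j }.

Record consensus_matrix (R : realType) (m : nat) (e : rel 'I_m) (W : 'M[R]_m)
    : Prop := {
  cmx_sym : W^T = W;
  cmx_ge0 : forall i j, 0 <= W i j;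
  cmx_row_sum : forall i, \sum_(j < m) W i j = 1;
  cmx_col_sum : forall j, \sum_(i < m) W i j = 1;
  cmx_edge : forall i j, i != j -> e i j -> 0 < W i j;
  cmx_nonedge : forall i j, i != j -> ~~ e i j -> W i j = 0 }.

(* s lists the eigenvalues of W with multiplicity in nonincreasing order, so
   that the k-th largest eigenvalue is s`_(k - 1). *)
Definition ordered_eigenvalues (R : realType) (m : nat) (W : 'M[R]_m)
    (s : seq R) : Prop :=
  sorted >=%R s /\ char_poly W = \prod_(a <- s) ('X - a%:P).

(* Worker i has the sample loss F i x z and the data distribution D i. *)
Definition local_loss (R : realType) (p m : nat) (d : measure_display)
    (Z : measurableType d) (D : 'I_m -> probability Z R)
    (F : 'I_m -> 'rV[R]_p -> Z -> R) (i : 'I_m) (x : 'rV[R]_p) : R :=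
  fine ('E_(D i)[F i x])%E.

Definition global_loss (R : realType) (p m : nat) (d : measure_display)
    (Z : measurableType d) (D : 'I_m -> probability Z R)
    (F : 'I_m -> 'rV[R]_p -> Z -> R) (x : 'rV[R]_p) : R :=
  m%:R^-1 * \sum_(i < m) local_loss D F i x.

Definition sgrad (R : realType) (p m : nat) (Z : Type)
    (F : 'I_m -> 'rV[R]_p -> Z -> R) (i : 'I_m) (x : 'rV[R]_p) (z : Z)
    : 'rV[R]_p :=
  grad (fun x' => F i x' z) x.

(* The first two fields and asm_sgrad_int only say that the sample gradients
   and the expectations defining the local losses and the mean stochastic
   gradients exist. *)
Record stochastic_problem (R : realType) (p m : nat) (d : measure_display)
    (Z : measurableType d) (D : 'I_m -> probability Z R)
    (F : 'I_m -> 'rV[R]_p -> Z -> R) (L sigma : R) : Prop := {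
  asm_sample_diff : forall i z x,
    differentiable ((fun x' => F i x' z) : 'rV[R]_p -> R^o) x;
  asm_sample_int : forall i x,
    (D i).-integrable setT (EFin \o F i x);
  asm_minimizer : exists xstar : 'rV[R]_p,
    forall x, global_loss D F xstar <= global_loss D F x;
  asm_diff : forall i x,
    differentiable (local_loss D F i : 'rV[R]_p -> R^o) x;
  asm_grad_cont : forall i, continuous (grad (local_loss D F i));
  asm_grad_lip : forall i x1 x2,
    enorm (grad (local_loss D F i) x1 - grad (local_loss D F i) x2)
      <= L * enorm (x1 - x2);
  asm_sgrad_int : forall i x (j : 'I_p),
    (D i).-integrable setT (fun z => (sgrad F i x z 0 j)%:E);
  asm_unbiased : forall i x (j : 'I_p),
    ('E_(D i)[(fun z => sgrad F i x z 0 j)%R])%E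
      = (grad (local_loss D F i) x 0 j)%:E;
  asm_variance : forall i x,
    ('E_(D i)[(fun z => enorm (sgrad F i x z - grad (local_loss D F i) x) ^+ 2)%R]
      <= (sigma ^+ 2)%:E)%E }.

(* Product rule over every finite subfamily of the family (X i)_(i in A). *)
Definition mutually_independent (R : realType) (d d' : measure_display)
    (T : measurableType d) (Z : measurableType d') (P : probability T R)
    (I : choiceType) (A : set I) (X : I -> T -> Z) : Prop :=
  forall (J : {fset I}) (B : I -> set Z),
    [set` J] `<=` A ->
    (forall i, measurable (B i)) ->
    P (\bigcap_(i in [set` J]) (X i @^-1` B i))
      = (\prod_(i <- J) P (X i @^-1` B i))%E.

(* The pairs (s, k) at which a fresh sample is drawn; at (s + 1, 0) the sample
   of (s, K) is reused. *)
Definition drawn (S K s k : nat) : bool :=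
  ((s == 0) && (k == 0) || (s < S) && (0 < k <= K))%N.

Definition netfleet_samples (R : realType) (m : nat) (d d' : measure_display)
    (T : measurableType d) (Z : measurableType d') (P : probability T R)
    (D : 'I_m -> probability Z R) (S K : nat)
    (zeta : 'I_m -> nat -> nat -> {RV P >-> Z}) : Prop :=
  (forall i s k, drawn S K s k ->
     forall B, measurable B -> distribution P (zeta i s k) B = D i B) /\
  mutually_independent P
    [set t : 'I_m * nat * nat | drawn S K t.1.2 t.2]
    (fun t => zeta t.1.1 t.1.2 t.2).

Arguments netfleet_samples {R m d d' T Z} P D S K zeta.

(* x s k i w, y s k i w and g s k i w are the values at outcome w of the
   iterate, the gradient tracker and the stochastic gradient of worker i in
   local round k of communication round s. *)
Record netfleet_iterates (R : realType) (p m : nat) (T Z : Type)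
    (F : 'I_m -> 'rV[R]_p -> Z -> R) (W : 'M[R]_m) (x0 : 'rV[R]_p) (eta : R)
    (S K : nat) (zeta : 'I_m -> nat -> nat -> T -> Z)
    (x y g : nat -> nat -> 'I_m -> T -> 'rV[R]_p) : Prop := {
  nf_x_init : forall i w, x 0 0 i w = x0;
  nf_g_init : forall i w, g 0 0 i w = sgrad F i (x 0 0 i w) (zeta i 0 0 w);
  nf_y_init : forall i w, y 0 0 i w = g 0 0 i w;
  nf_g : forall s k i w, (s < S)%N -> (0 < k <= K)%N ->
    g s k i w = sgrad F i (x s k i w) (zeta i s k w);
  nf_x_mix : forall s i w, (s < S)%N ->
    x s 1 i w = \sum_(j < m) W i j *: x s 0 j w - eta *: y s 0 i w;
  nf_y_mix : forall s i w, (s < S)%N ->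
    y s 1 i w = \sum_(j < m) W i j *: y s 0 j w + g s 1 i w - g s 0 i w;
  nf_x_local : forall s k i w, (s < S)%N -> (0 < k < K)%N ->
    x s k.+1 i w = x s k i w - eta *: y s k i w;
  nf_y_local : forall s k i w, (s < S)%N -> (0 < k < K)%N ->
    y s k.+1 i w = y s k i w + g s k.+1 i w - g s k i w;
  nf_x_next : forall s i w, (s < S)%N -> x s.+1 0 i w = x s K i w;
  nf_y_next : forall s i w, (s < S)%N -> y s.+1 0 i w = y s K i w;
  nf_g_next : forall s i w, (s < S)%N -> g s.+1 0 i w = g s K i w }.

Definition C1 (R : realType) (lam : R) (K : nat) : R :=
  6%:R * (1 + lam * K%:R - lam) * K%:R / (1 - lam) ^+ 2.

(* xs and ys are the iterates and trackers of all workers at one (s, k). *)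
Definition potential (R : realType) (p m : nat) (f : 'rV[R]_p -> R)
    (lam eta : R) (K : nat) (xs ys : 'I_m -> 'rV[R]_p) : R :=
  f (avg xs) +
  (m%:R ^+ 2 * K%:R)^-1 *
  \sum_(i < m) (enorm (xs i - avg xs) ^+ 2
                + C1 lam K * eta ^+ 2 * enorm (ys i - avg ys) ^+ 2).

Definition stationarity_gap (R : realType) (p m : nat) (f : 'rV[R]_p -> R)
    (L : R) (xs : 'I_m -> 'rV[R]_p) : R :=
  enorm (grad f (avg xs)) ^+ 2 +
  L ^+ 2 / m%:R * \sum_(i < m) enorm (xs i - avg xs) ^+ 2.

(* Main.v *)
Require Import Defs.
From HB Require Import structures.
From mathcomp Require Import all_boot all_order all_algebra.
From mathcomp Require Import finmap.
From mathcomp Require Import all_classical all_reals all_analysis.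
From mathcomp Require Import measurable_realfun.
From mathcomp Require Import ring lra.
From mathcomp Require complex.

(* Only K = S^(1/3)/m matters: it gives S = (mK)^3, hence eta = c/(m K^2) and
   sqrt(SKm) = m^2 K^2, so that eta S K = c sqrt(SKm) and the bound is a
   descent inequality for the potential, summed over all steps and divided by
   eta S K.

   Write X and U for the dispersions of the x's and (times C1 eta^2) of the y's
   around their means. Since y_k = W y_0 + g_k - g_0 inside a round, one round
   contracts X + U by the factor 1 - (1 - lambda)/2, up to the drift of the
   stochastic gradients; this uses |W v| <= lambda |v| for v orthogonal to the
   constants. As mean y_k = mean g_k, the mean iterate performs a perturbed
   gradient step, and the descent lemma bounds the decrease of f. For small c
   the two estimates combine into an inequality valid for every outcome, whose
   only random terms are the gradient errors xi = g - grad f_i(x). Its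
   expectation is taken once: conditionally on all other samples xi_i has mean
   zero and variance at most sigma^2, so the term linear in xi vanishes and
   |mean xi|^2 has expectation at most sigma^2/m. *)

Set Implicit Arguments.
Unset Strict Implicit.
Unset Printing Implicit Defensive.

Import Order.TTheory GRing.Theory Num.Theory.
Import numFieldNormedType.Exports.

Local Open Scope classical_set_scope.
Local Open Scope ring_scope.

(** * Spectral contraction of the consensus matrix *)

Section Spectral.
Import complex.
Local Open Scope sesquilinear_scope.

(** The step-size is fixed by the dispersion. Over one round the dispersions cost about 3 eta L^2
    K/m times the value V of X + U at its start, while the weight 1/(m^2 K) in the potential gives
    back (1 - lambda)/2 times V/(m^2 K). The balance asks that eta m K^2 be bounded in terms of L
    and lambda, and eta = c/(m K^2) achieves this for all m and K at once. The same choice makes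
    eta^2 S K/m equal to c^2, so that the accumulated noise stays of order sigma^2.

    Two circular dependences shape the estimates. Dispersion depends on the drift of the gradients,
    which depends on dispersion; smallness of eta K L closes this loop inside a round. The drift
    also depends on the motion of the mean, hence on the mean exact gradients, which no contraction
    controls; they are carried along as [H] until the negative square in the descent inequality
    absorbs them.

    Conditioning is done by Fubini: the law of all other samples together with a fresh one is a
    product measure. *)

Lemma char_poly_spectral (C : numClosedFieldType) n (A : 'M[C]_n) :
  A \is normalmx ->
  char_poly A = \prod_(j < n) ('X - (spectral_diag A 0 j)%:P).
Proof.
move=> /orthomx_spectralP AE.
set P := spectralmx A in AE; set sp := spectral_diag A in AE *.
have uP : P \in unitmx by apply: spectral_unit.
have -> : char_poly A = char_poly (diag_mx sp).
  rewrite AE /char_poly /char_poly_mx !map_mxM.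
  set Q := map_mx polyC P; set Q' := map_mx polyC (invmx P).
  have QQ : Q' *m Q = 1%:M by rewrite -map_mxM mulVmx // map_mx1.
  have -> : 'X%:M - Q' *m map_mx polyC (diag_mx sp) *m Q =
      Q' *m ('X%:M - map_mx polyC (diag_mx sp)) *m Q.
    by rewrite mulmxBr mulmxBl scalar_mxC -(mulmxA 'X%:M) QQ mulmx1.
  rewrite !det_mulmx mulrAC.
  have : \det Q' * \det Q = 1 by rewrite -det_mulmx QQ det1.
  by move=> ->; rewrite mul1r.
rewrite char_poly_trig ?diag_mx_is_trig //.
by apply: eq_bigr => j _; rewrite mxE eqxx mulr1n.
Qed.

Lemma spectral_dot (C : numClosedFieldType) n (Q : 'M[C]_n) (u v : 'rV[C]_n) :
  Q \is unitarymx -> (u *m Q^t*) *m (v *m Q^t*)^t* = u *m v^t*.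
Proof.
move=> Qu; rewrite trmx_mul map_mxM -!mulmxA trmxCK.
have := Qu; rewrite -trmxC_unitary => /unitarymxP; rewrite trmxCK => QQ.
by rewrite (mulmxA _ Q) QQ mul1mx.
Qed.

(** In an orthonormal eigenbasis [A] scales each coordinate by an eigenvalue. The fixed vector [one]
    is supported on the eigenvalue 1, which is simple, so orthogonality to [one] kills that
    coordinate of [v]; all others shrink by at most [lam]. *)
Lemma contraction_row_complex (C : numClosedFieldType) n (A : 'M[C]_n) (eigs : seq C)
    (lam : C) (one v : 'rV[C]_n) :
  A \is normalmx -> char_poly A = ('X - 1%:P) * \prod_(a <- eigs) ('X - a%:P) ->
  1 \notin eigs -> {in eigs, forall a, `|a| <= lam} ->
  one *m A = one -> one != 0 -> v *m one^t* = 0 -> 0 <= lam ->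
  (v *m A *m (v *m A)^t*) 0 0 <= lam ^+ 2 * (v *m v^t*) 0 0.
Proof.
move=> nA cA n1 hl oneA one0 v1 lam0.
have cA' := char_poly_spectral nA.
have := nA; move=> /orthomx_spectralP AE.
set P := spectralmx A in AE; set sp := spectral_diag A in AE cA'.
have uP : P \is unitarymx by apply: spectral_unitarymx.
rewrite invmx_unitary // in AE.
have PP : P *m P^t* = 1%:M by apply/unitarymxP.
have pe : perm_eq [seq sp 0 j | j <- enum 'I_n] (1 :: eigs).
  by apply: prod_XsubC_eq; rewrite big_cons -cA cA' big_map big_enum.
pose u := v *m P^t*; pose o := one *m P^t*.
have oE j : o 0 j * sp 0 j = o 0 j.
  have : o *m diag_mx sp = o.
    by rewrite /o -[in RHS]oneA AE -!mulmxA PP mulmx1 !mulmxA.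
  by move/matrixP/(_ 0 j); rewrite mul_mx_diag mxE.
have uo : u *m o^t* = 0 by rewrite spectral_dot.
have o0 : o != 0.
  apply: contra one0 => /eqP o0.
  have : one = o *m P.
    rewrite /o -mulmxA -[RHS]/(one *m (P^t* *m P)).
    by rewrite (mulmx1C PP) mulmx1.
  by rewrite o0 mul0mx => ->.
have dotE (w : 'rV[C]_n) : (w *m w^t*) 0 0 = \sum_j `|w 0 j| ^+ 2.
  by rewrite mxE; apply: eq_bigr => j _; rewrite !mxE normCK.
have -> : (v *m A *m (v *m A)^t*) 0 0 = \sum_j `|u 0 j * sp 0 j| ^+ 2.
  rewrite -(spectral_dot _ _ uP) dotE.
  apply: eq_bigr => j _; congr (`|_| ^+ 2).
  have -> : v *m A *m P^t* = u *m diag_mx sp.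
    by rewrite AE -!mulmxA PP mulmx1 !mulmxA.
  by rewrite mul_mx_diag mxE.
have -> : (v *m v^t*) 0 0 = \sum_j `|u 0 j| ^+ 2 by rewrite -(spectral_dot _ _ uP) dotE.
have spm j : sp 0 j \in 1 :: eigs.
  by rewrite -(perm_mem pe); apply/mapP; exists j; rewrite ?mem_enum.
(* The value 1 occurs once in [1 :: eigs], hence at one index of the spectral diagonal. *)
have uniq1 j j' : sp 0 j = 1 -> sp 0 j' = 1 -> j = j'.
  move=> s1 s2; apply/eqP/negPn/negP => jj'.
  have : (count_mem (1%R : C) [seq sp 0%R j | j <- enum 'I_n] <= 1)%N.
    by rewrite (permP pe) /= eqxx (count_memPn n1).
  rewrite count_map -size_filter => sz.
  have sub : {subset [:: j; j'] <= [seq i <- enum 'I_n | preim (sp 0) (pred1 1) i]}.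
    by move=> i; rewrite !inE mem_filter mem_enum /= => /orP[] /eqP ->; rewrite ?s1 ?s2 eqxx.
  have := uniq_leq_size _ sub; rewrite /= inE jj' => /(_ isT) h.
  by have := leq_trans h sz.
rewrite mulr_sumr; apply: ler_sum => j _; rewrite normrM exprMn mulrC.
have := spm j; rewrite inE => /orP[/eqP s1|/hl h]; last first.
  by rewrite ler_wpM2r ?exprn_ge0 // lerXn2r ?nnegrE.
(* At the index of eigenvalue 1, [o] has its only nonzero coordinate, so [uo] forces that of [u] to
   vanish. *)
suff -> : u 0 j = 0 by rewrite normr0 expr0n /= !mulr0.
have oo j' : j' != j -> o 0 j' = 0.
  move=> jj'; have : sp 0 j' != 1 by apply: contra jj' => /eqP h; apply/eqP/uniq1.
  move=> h; have : o 0 j' * (sp 0 j' - 1) = 0 by rewrite mulrBr mulr1 oE subrr.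
  by move/eqP; rewrite mulf_eq0 subr_eq0 (negPf h) orbF => /eqP.
have oj : o 0 j != 0.
  apply: contra o0 => /eqP oj; apply/eqP/matrixP => a b; rewrite ord1 [RHS]mxE.
  by have [->//|bj] := eqVneq b j; apply: oo.
move/matrixP/(_ 0 0): uo; rewrite mxE (bigD1 j) //= big1 ?addr0; last first.
  by move=> i ij; rewrite [X in _ * X]mxE [in X in _ * X]mxE oo // conjC0 mulr0.
rewrite [X in _ * X]mxE [in X in _ * X]mxE [RHS]mxE => /eqP.
by rewrite mulf_eq0 conjC_eq0 (negPf oj) orbF => /eqP.
Qed.
End Spectral.

Section SpectralReal.
Import complex.
Local Open Scope sesquilinear_scope.
Local Open Scope complex_scope.

(** Embedded in the complex matrices, a real symmetric matrix is Hermitian, hence normal;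
    conjugation fixes its entries, so both Hermitian squares are real sums of squares. *)
Lemma contraction_row (R : realType) n (A : 'M[R]_n) (eigs : seq R) (lam : R)
    (v : 'rV[R]_n) :
  (0 < n)%N -> A^T = A -> (forall j, \sum_i A i j = 1) ->
  char_poly A = ('X - 1%:P) * \prod_(a <- eigs) ('X - a%:P) ->
  1 \notin eigs -> {in eigs, forall a, `|a| <= lam} -> 0 <= lam ->
  \sum_i v 0 i = 0 ->
  \sum_i (v *m A) 0 i ^+ 2 <= lam ^+ 2 * \sum_i v 0 i ^+ 2.
Proof.
move=> n0 symA sumA cA n1 hl lam0 v0.
pose f := real_complex R.
have conjR (x : R) : Num.conj (x%:C : R[i]) = x%:C by exact: conjc_real.
have rlm k l (B : 'M[R]_(k, l)) : map_mx f B \is a realmx.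
  by apply/mxOverP => i j; rewrite mxE; apply/CrealP; exact: conjR.
have tc k l (B : 'M[R]_(k, l)) : (map_mx f B)^t* = map_mx f B^T.
  by apply/matrixP => i j; rewrite !mxE; exact: conjR.
have dotE k (w : 'rV[R]_k) :
    (map_mx f w *m (map_mx f w)^t*) 0 0 = (\sum_i w 0 i ^+ 2)%:C.
  rewrite tc -map_mxM mxE; congr (_%:C); rewrite mxE.
  by apply: eq_bigr => i _; rewrite mxE expr2.
suff : (map_mx f v *m map_mx f A *m (map_mx f v *m map_mx f A)^t*) 0 0
    <= (lam%:C) ^+ 2 * (map_mx f v *m (map_mx f v)^t*) 0 0.
  by rewrite -map_mxM !dotE -rmorphXn -rmorphM lecR.
apply: (@contraction_row_complex _ _ _ (map f eigs) _ (const_mx 1)).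
- apply: symmetric_normalmx => //; apply/is_hermitianmxP.
  by rewrite expr0 scale1r map_mx_id //; apply/matrixP => i j; rewrite !mxE -{1}symA mxE.
- rewrite -map_char_poly cA rmorphM rmorphB /= map_polyX map_polyC /= rmorph1.
  by rewrite rmorph_prod big_map; congr (_ * _); apply: eq_bigr => a _;
    rewrite rmorphB /= map_polyX map_polyC.
- by apply: contra n1 => /mapP[a ae /complexI ->].
- by move=> _ /mapP[a ae ->]; rewrite normc_def /= expr0n addr0 sqrtr_sqr lecR hl.
- apply/matrixP => i j; rewrite !mxE.
  under eq_bigr do rewrite !mxE mul1r.
  by rewrite -rmorph_sum sumA rmorph1.
- by apply/negP => /eqP/matrixP/(_ 0 (Ordinal n0))/eqP; rewrite !mxE oner_eq0.
- apply/matrixP => i j; rewrite !mxE.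
  under eq_bigr do rewrite !mxE conjC1 mulr1.
  by rewrite -rmorph_sum ord1 v0 rmorph0.
- by rewrite lecR.
Qed.
End SpectralReal.

Section Dispersion.
Variables (R : realType) (m p : nat).
Implicit Types (A B : 'M[R]_(m, p)).

(** The squared Frobenius norm; on a row vector it is the squared Euclidean norm. *)
Definition sqn k l (A : 'M[R]_(k, l)) : R := \sum_i \sum_j A i j ^+ 2.

Definition mean A : 'rV[R]_p := m%:R^-1 *: \sum_i row i A.

Definition dev A : 'M[R]_(m, p) := A - \matrix_i mean A.

Lemma mean_mulmx (W : 'M[R]_m) A :
  (forall j, \sum_i W i j = 1) -> mean (W *m A) = mean A.
Proof.
move=> cW; rewrite /mean; congr (_ *: _); apply/rowP => j.
rewrite !summxE; under eq_bigr do rewrite !mxE.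
rewrite exchange_big; apply: eq_bigr => i _.
by rewrite -mulr_suml cW mul1r mxE.
Qed.

Lemma dev_mulmx (W : 'M[R]_m) A :
  (forall j, \sum_i W i j = 1) -> (forall i, \sum_j W i j = 1) ->
  dev (W *m A) = W *m dev A.
Proof.
move=> cW rW; rewrite /dev mean_mulmx // mulmxBr; congr (_ - _).
apply/matrixP => i j; rewrite [LHS]mxE [RHS]mxE.
by under [RHS]eq_bigr do rewrite mxE; rewrite -mulr_suml rW mul1r.
Qed.

Lemma dev_col_sum A j : \sum_i dev A i j = 0.
Proof.
under eq_bigr do rewrite !mxE.
rewrite sumrB sumr_const card_ord summxE.
have [m0|m0] := posnP m.
  have noI (i : 'I_m) : False by move: (ltn_ord i); rewrite [X in (_ < X)%N]m0.
  by rewrite big1 => [|i]; [rewrite [X in _ *+ X]m0 mulr0n subrr|case: (noI i)].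
rewrite -mulrnAl -[X in X * _]mulr_natr mulVf ?pnatr_eq0 -?lt0n // mul1r.
by apply/eqP; rewrite subr_eq0; apply/eqP/eq_bigr => i _; rewrite mxE.
Qed.

(** Sorting places every eigenvalue but the first between the last and the second, so it is at most
    [lam] in absolute value and differs from 1. *)
Lemma consensus_contraction (e : rel 'I_m) (W : 'M[R]_m) (eigs : seq R) (lam : R) A :
  (1 < m)%N -> consensus_matrix e W -> ordered_eigenvalues W eigs ->
  eigs`_0 = 1 -> eigs`_1 < 1 -> -1 < eigs`_m.-1 ->
  lam = Num.max `|eigs`_1| `|eigs`_m.-1| ->
  [/\ 0 <= lam, lam < 1 & sqn (W *m dev A) <= lam ^+ 2 * sqn (dev A)].
Proof.
move=> m1 cW [srt cp] e0 e1 em lamE.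
have sz : size eigs = m.
  by have := size_char_poly W; rewrite cp size_prod_XsubC => -[].
have [m' mE] : exists m', m = m'.+2 by case: (m) m1 => [|[|k]] // _; exists k.
have srtP i j : (i <= j < m)%N -> eigs`_j <= eigs`_i.
  move=> /andP[ij jm].
  have := @sorted_leq_nth _ >=%R ge_trans (@ge_refl _ _) 0 eigs srt i j.
  by apply => //; rewrite inE sz //; exact: leq_ltn_trans jm.
have lam0 : 0 <= lam by rewrite lamE le_max normr_ge0.
have le1m : eigs`_m.-1 <= eigs`_1 by apply: srtP; rewrite mE /= ltnSn.
split => //.
  rewrite lamE gt_max !ltr_norml e1 em (lt_le_trans em le1m) /=.
  exact: le_lt_trans e1.
have eigsE : eigs = 1 :: behead eigs by rewrite -e0; case: (eigs) sz => //; rewrite mE.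
have bh a : a \in behead eigs -> eigs`_m.-1 <= a <= eigs`_1.
  move=> /(nthP 0)[i]; rewrite size_behead sz nth_behead => im <-.
  have im' : (i.+1 < m)%N by rewrite mE /= in im *.
  by rewrite !srtP //= ?im' // mE /= ltnSn andbT -ltnS -mE.
(* The columns of [dev A] sum to zero. Symmetry of [W] turns its action on a column into the action
   on the transposed row. *)
have row_ineq j : \sum_i (W *m dev A) i j ^+ 2 <= lam ^+ 2 * \sum_i dev A i j ^+ 2.
  have := @contraction_row R m W (behead eigs) lam (col j (dev A))^T.
  have -> : (col j (dev A))^T *m W = (col j (W *m dev A))^T.
    by rewrite -{1}(cmx_sym cW) -trmx_mul !colE mulmxA.
  have tcE B : \sum_i (col j B)^T 0 i ^+ 2 = \sum_i B i j ^+ 2.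
    by apply: eq_bigr => i _; rewrite !mxE.
  rewrite !tcE; apply => //.
  - by rewrite mE.
  - exact: cmx_sym cW.
  - exact: cmx_col_sum cW.
  - by rewrite cp {1}eigsE big_cons.
  - by apply/negP => /bh /andP[_]; rewrite leNgt e1.
  - move=> a /bh /andP[ma a1]; rewrite lamE le_max.
    have [a0|a0] := leP 0 a.
      by rewrite (ger0_norm a0) (le_trans a1) ?ler_norm.
    by rewrite orbC ltr0_norm // (ltr0_norm (le_lt_trans ma a0)) lerN2 ma.
  - by rewrite -[RHS](dev_col_sum A j); apply: eq_bigr => i _; rewrite !mxE.
rewrite /sqn exchange_big [X in _ <= _ * X]exchange_big mulr_sumr.
exact: ler_sum.
Qed.
End Dispersion.

(** * One communication round *)

Lemma sqr_sum_le (R : realDomainType) n (a : 'I_n -> R) :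
  (\sum_i a i) ^+ 2 <= n%:R * \sum_i a i ^+ 2.
Proof.
elim: n a => [|n IH] a; first by rewrite !big_ord0 expr0n mulr0.
rewrite !big_ord_recl; set s := \sum_i _; set q := \sum_i _ ^+ 2.
have IH' : s ^+ 2 <= n%:R * q by exact: IH.
have cross : 2 * (a ord0 * s) <= n%:R * a ord0 ^+ 2 + q.
  have -> : n%:R * a ord0 ^+ 2 = \sum_(i < n) a ord0 ^+ 2.
    by rewrite sumr_const card_ord mulr_natl.
  rewrite /s /q 2!mulr_sumr -big_split.
  by apply: ler_sum => i _; have := sqr_ge0 (a ord0 - a (lift ord0 i)) => /=; nra.
have -> : n.+1%:R = n%:R + 1 :> R by rewrite -natr1.
nra.
Qed.

(** * Inequalities for the squared Frobenius norm *)

Section SquareNorm.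
Variables (R : realType) (m p : nat).
Implicit Types (A B : 'M[R]_(m, p)).

Lemma sqn_ge0 A : 0 <= sqn A.
Proof. by do 2!apply: sumr_ge0 => ? _; exact: sqr_ge0. Qed.

Lemma sqnZ a A : sqn (a *: A) = a ^+ 2 * sqn A.
Proof.
rewrite /sqn mulr_sumr; apply: eq_bigr => i _; rewrite mulr_sumr.
by apply: eq_bigr => j _; rewrite mxE exprMn.
Qed.

Lemma sqnN A : sqn (- A) = sqn A.
Proof. by rewrite -scaleN1r sqnZ sqrrN expr1n mul1r. Qed.

Lemma sqn_eq0 A : sqn A = 0 -> A = 0.
Proof.
move=> /eqP; rewrite psumr_eq0 => [/allP h|i _]; last first.
  by apply: sumr_ge0 => j _; exact: sqr_ge0.
apply/matrixP => i j; have /implyP/(_ isT) := h i (mem_index_enum i).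
rewrite psumr_eq0 => [/allP/(_ j (mem_index_enum j))/implyP/(_ isT)|k _]; last exact: sqr_ge0.
by rewrite sqrf_eq0 mxE => /eqP.
Qed.

Lemma sqn_combo (a b : R) A B C :
  (forall u v w : R, w = u + v -> w ^+ 2 <= a * u ^+ 2 + b * v ^+ 2) ->
  C = A + B -> sqn C <= a * sqn A + b * sqn B.
Proof.
move=> h ->; rewrite /sqn !mulr_sumr -big_split; apply: ler_sum => i _.
rewrite !mulr_sumr -big_split; apply: ler_sum => j _.
by apply: h; rewrite mxE.
Qed.

Lemma sqnD2 A B : sqn (A + B) <= 2 * sqn A + 2 * sqn B.
Proof.
apply: sqn_combo => // u v _ ->.
by have := sqr_ge0 (u - v); nra.
Qed.

Lemma sqnB2 A B : sqn (A - B) <= 2 * sqn A + 2 * sqn B.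
Proof. by rewrite -(sqnN B) sqnD2. Qed.

Lemma sqnD_convex (t : R) A B : 0 < t < 1 ->
  sqn (A + B) <= t^-1 * sqn A + (1 - t)^-1 * sqn B.
Proof.
move=> /andP[t0 t1]; apply: sqn_combo => // u v _ ->.
have t1' : 0 < 1 - t by lra.
rewrite -subr_ge0.
have -> : t^-1 * u ^+ 2 + (1 - t)^-1 * v ^+ 2 - (u + v) ^+ 2 =
    ((1 - t) * u - t * v) ^+ 2 / (t * (1 - t)).
  by field; rewrite !gt_eqF.
by rewrite divr_ge0 ?sqr_ge0 // mulr_ge0 ?ltW.
Qed.

(** The weight in the convexity bound is the contraction factor itself, so that t^2/t leaves a
    factor t in front of [a]. *)
Lemma sqnD_contraction (t a : R) A B : 0 <= t < 1 -> sqn A <= t ^+ 2 * a ->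
  sqn (A + B) <= t * a + (1 - t)^-1 * sqn B.
Proof.
(* For t = 0 the weight 1/t is meaningless, but then [A] vanishes. *)
move=> /andP[]; rewrite le_eqVlt => /orP[/eqP <- _|t0 t1 hA].
  rewrite expr0n /= !mul0r => hA; have -> : A = 0.
    by apply: sqn_eq0; apply/eqP; rewrite eq_le hA sqn_ge0.
  by rewrite add0r subr0 invr1 mul1r add0r.
apply: (le_trans (sqnD_convex _ _ _ (t := t))); first by rewrite t0.
by rewrite lerD2r ler_pdivrMl // mulrA -expr2.
Qed.

(** The triangle inequality |A + cB| <= (1 + tc)|A|, squared; the weight 1/(1 + tc) is the one for
    which the convexity bound loses nothing. *)
Lemma sqnD_scale (t c : R) A B : 0 <= t < 1 -> 0 <= c ->
  sqn B <= t ^+ 2 * sqn A -> sqn (A + c *: B) <= (1 + t * c) ^+ 2 * sqn A.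
Proof.
move=> /andP[t0 t1] c0 hB.
have [->|cN0] := eqVneq c 0.
  by rewrite scale0r addr0 mulr0 addr0 expr1n mul1r.
have [tz|tN0] := eqVneq t 0.
  have -> : B = 0.
    apply: sqn_eq0; apply/eqP; rewrite eq_le sqn_ge0 andbT.
    by rewrite tz expr0n /= mul0r in hB.
  by rewrite scaler0 addr0 tz mul0r addr0 expr1n mul1r.
have t0' : 0 < t by rewrite lt_def tN0.
have c0' : 0 < c by rewrite lt_def cN0.
have s0 : 0 < 1 + t * c by rewrite addr_gt0 ?mulr_gt0.
have s01 : 0 < (1 + t * c)^-1 < 1.
  by rewrite invr_gt0 s0 invf_lt1 // ltrDl mulr_gt0.
apply: (le_trans (sqnD_convex _ _ s01)); rewrite invrK sqnZ.
have -> : (1 - (1 + t * c)^-1)^-1 = (1 + t * c) / (t * c).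
  rewrite -[RHS]invf_div; congr (_^-1); field.
  by rewrite gt_eqF.
have -> : (1 + t * c) / (t * c) * (c ^+ 2 * sqn B) = (1 + t * c) * (c / t) * sqn B.
  by field; rewrite !gt_eqF.
apply: (@le_trans _ _ ((1 + t * c) * sqn A + (1 + t * c) * (c / t) * (t ^+ 2 * sqn A))).
  by rewrite lerD2l ler_wpM2l // mulr_ge0 ?divr_ge0 ?ltW.
rewrite le_eqVlt; apply/orP; left; apply/eqP.
by field; rewrite gt_eqF.
Qed.

Lemma sqn_sum_le n (A : 'I_n -> 'M[R]_(m, p)) :
  sqn (\sum_i A i) <= n%:R * \sum_i sqn (A i).
Proof.
have -> : \sum_i sqn (A i) = \sum_k \sum_j \sum_i A i k j ^+ 2.
  by rewrite exchange_big; apply: eq_bigr => k _; rewrite exchange_big.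
rewrite /sqn mulr_sumr; apply: ler_sum => k _; rewrite mulr_sumr; apply: ler_sum => j _.
by rewrite summxE; exact: sqr_sum_le.
Qed.

Lemma meanD A B : mean (A + B) = mean A + mean B.
Proof.
by rewrite /mean -scalerDr -big_split; congr (_ *: _); apply: eq_bigr => i _; rewrite linearD.
Qed.

Lemma meanZ a A : mean (a *: A) = a *: mean A.
Proof.
rewrite /mean scalerA mulrC -scalerA; congr (_ *: _); rewrite scaler_sumr.
by apply: eq_bigr => i _; rewrite linearZ.
Qed.

Lemma meanB A B : mean (A - B) = mean A - mean B.
Proof. by rewrite -scaleN1r meanD meanZ scaleN1r. Qed.

Lemma devD A B : dev (A + B) = dev A + dev B.
Proof. by rewrite /dev meanD; apply/matrixP => i j; rewrite !mxE; ring. Qed.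

Lemma devZ a A : dev (a *: A) = a *: dev A.
Proof. by rewrite /dev meanZ; apply/matrixP => i j; rewrite !mxE; ring. Qed.

Lemma devB A B : dev (A - B) = dev A - dev B.
Proof. by rewrite -scaleN1r devD devZ scaleN1r. Qed.

(** Pythagoras: the deviations sum to zero in each column, so the cross term vanishes. *)
Lemma sqn_dev_mean A : sqn A = sqn (dev A) + m%:R * sqn (mean A).
Proof.
rewrite [sqn (mean A)]/sqn big_ord1 /sqn exchange_big [in RHS]exchange_big mulr_sumr -big_split.
apply: eq_bigr => j _ /=.
have dE i : A i j ^+ 2 = dev A i j ^+ 2 + (mean A 0 j *+ 2 * dev A i j + mean A 0 j ^+ 2).
  rewrite [A i j](_ : _ = dev A i j + mean A 0 j); first by ring.
  by rewrite /dev 3!(mxE _ _ i j) subrK.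
under eq_bigr do rewrite dE.
rewrite big_split big_split /= -mulr_sumr dev_col_sum mulr0 add0r.
by rewrite sumr_const card_ord mulr_natl.
Qed.

Lemma sqn_dev_le A : sqn (dev A) <= sqn A.
Proof.
by rewrite [leRHS]sqn_dev_mean lerDl mulr_ge0 // ?ler0n //;
  do 2!apply: sumr_ge0 => ? _; exact: sqr_ge0.
Qed.

Lemma sqn_mean_le A : m%:R * sqn (mean A) <= sqn A.
Proof. by rewrite [leRHS]sqn_dev_mean lerDr sqn_ge0. Qed.

End SquareNorm.

(** * Scalar inequalities behind the contraction of one round *)

Section RoundArithmetic.
Variable R : realFieldType.

(** [Q] and [E] bound each other. Substituting [Q] returns [E] with the coefficient 8 ep/mu, at most
    1/2 for small [ep], so it is absorbed on the left. *)
Lemma round_drift_bound (lam mu ep X0 U0 E R0 Q : R) :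
  mu = 1 - lam -> 0 <= lam -> 0 < mu -> 0 <= ep -> 576 * ep <= mu ^+ 4 ->
  0 <= X0 -> 0 <= U0 -> 0 <= E ->
  Q = lam * X0 + mu / 3 * U0 + 2 / mu * E ->
  E <= 4 * ep * (Q + X0) + R0 ->
  E <= 16 * ep * (X0 + U0) + 2 * R0.
Proof.
move=> muE lam0 mu0 ep0 hep X00 U00 E0 QE hE.
have mu1 : mu <= 1 by lra.
have hmu : mu ^+ 4 <= mu.
  rewrite -[leRHS]mulr1 exprS ler_wpM2l ?exprn_ile1 // ltW //.
have h1 : 8 * ep / mu <= 1 / 2 by rewrite ler_pdivrMr //; lra.
have h2 : 8 * ep / mu * E <= E / 2 by rewrite mulrC ler_wpM2l //; lra.
have h3 : lam * X0 <= X0 by rewrite ler_piMl //; lra.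
have h4 : mu / 3 * U0 <= U0 by rewrite ler_piMl //; lra.
have h5 : 4 * ep * (lam * X0 + mu / 3 * U0 + X0) <= 4 * ep * (2 * X0 + U0).
  by rewrite ler_wpM2l ?mulr_ge0 //; lra.
have h6 : 4 * ep * (Q + X0) =
  4 * ep * (lam * X0 + mu / 3 * U0 + X0) + 8 * ep / mu * E.
  by rewrite QE; field; rewrite gt_eqF.
have h7 : 0 <= ep * U0 by rewrite mulr_ge0.
lra.
Qed.

(** Without drift, X + U drops to (1 - mu) X0 + (1 - 2 mu/3) U0, which is better than the factor 1 -
    mu/2 by at least mu/6. This margin pays for the drift, which enters with weight 24/mu^3; hence
    [ep] must be of order mu^4. *)
Lemma round_contraction_arith (lam mu ep X0 U0 E R0 Q XK UK DK G : R) :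
  mu = 1 - lam -> 0 <= lam -> 0 < mu -> 0 <= ep -> 576 * ep <= mu ^+ 4 ->
  0 <= X0 -> 0 <= U0 -> 0 <= E -> 0 <= R0 ->
  Q = lam * X0 + mu / 3 * U0 + 2 / mu * E ->
  E <= 16 * ep * (X0 + U0) + 2 * R0 ->
  XK <= Q ->
  UK <= lam * U0 + 24 / mu ^+ 3 * DK ->
  DK <= ep * (Q + X0) + G ->
  XK + UK <= (1 - mu / 2) * (X0 + U0) + 24 / mu ^+ 3 * (R0 / 4 + G) /\
  X0 + Q <= 3 * (X0 + U0) + 4 / mu * R0.
Proof.
move=> muE lam0 mu0 ep0 hep X00 U00 E0 R00 QE hE hXK hUK hDK.
have mu1 : mu <= 1 by lra.
pose i := mu^-1.
have i0 : 0 < i by rewrite invr_gt0.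
have mui : mu * i = 1 by rewrite mulfV // gt_eqF.
have i1 : 1 <= i by rewrite invf_ge1.
(* [c] is the size of [ep] after division by mu^3; by [hc] it is a small fraction of the margin. *)
pose c := ep * i ^+ 3.
have c0 : 0 <= c by rewrite mulr_ge0 // exprn_ge0 // ltW.
have hc : 576 * c <= mu.
  have -> : mu = mu ^+ 4 * i ^+ 3.
    by rewrite exprS -mulrA -exprMn mui expr1n mulr1.
  by rewrite mulrA ler_wpM2r // exprn_ge0 // ltW.
have iep : i * ep <= c.
  by rewrite mulrC ler_wpM2l // ler_eXnr.
rewrite -[24 / _]/(24 * (mu ^+ 3)^-1) -exprVn -/i in hUK *.
rewrite -[2 / mu]/(2 * i) in QE; rewrite -[4 / mu]/(4 * i).
pose V := X0 + U0.
have V0 : 0 <= V by rewrite addr_ge0.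
have iE : i * E <= 16 * (i * ep) * V + 2 * i * R0.
  have : i * E <= i * (16 * ep * V + 2 * R0) by rewrite ler_wpM2l // ltW.
  by move/le_trans; apply; rewrite le_eqVlt; apply/orP; left; apply/eqP; ring.
have cV : i * ep * V <= c * V by rewrite ler_wpM2r.
have cmu : 576 * c * V <= mu * V by rewrite ler_wpM2r.
have muV : mu * V <= V by rewrite ler_piMl.
have lX : 0 <= mu * X0 by rewrite mulr_ge0 // ltW.
have lU : 0 <= mu * U0 by rewrite mulr_ge0 // ltW.
have muU : mu * U0 <= U0 by rewrite ler_piMl.
have QX : Q + X0 <= 2 * V + 2 * (i * E).
  by rewrite QE muE /V in lX lU muU *; lra.
have iER : 0 <= i * R0 by rewrite mulr_ge0 // ltW.
split; last by rewrite -/V; nra.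
have hiD : i ^+ 3 * DK <= c * (2 * V + 2 * (i * E)) + i ^+ 3 * G.
  apply: (le_trans (ler_wpM2l (exprn_ge0 3 (ltW i0)) hDK)).
  have : c * (Q + X0) <= c * (2 * V + 2 * (i * E)) by rewrite ler_wpM2l.
  by rewrite /c; nra.
have ciE : 576 * (c * (i * E)) <= i * E.
  rewrite mulrA; apply: ler_piMl; [exact (mulr_ge0 (ltW i0) E0) | exact: le_trans hc mu1].
have iR3 : i * R0 <= i ^+ 3 * R0.
  by rewrite ler_wpM2r // ler_eXnr.
have XU : XK + UK <= V - mu * X0 - 2 / 3 * (mu * U0) + 2 * (i * E) + 24 * (i ^+ 3 * DK).
  by rewrite QE muE in hXK *; rewrite /V; lra.
have hV : (1 - mu / 2) * V = V - mu * X0 / 2 - mu * U0 / 2 by rewrite /V; ring.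
have muVE : mu * V = mu * X0 + mu * U0 by rewrite /V; ring.
rewrite -/V hV; lra.
Qed.
End RoundArithmetic.

(** * One round from its start, with [h] standing for the exact local gradients *)

Section Round.
Variables (R : realType) (m p K : nat) (W : 'M[R]_m) (lam eta L : R).
Variables x y g h : nat -> 'M[R]_(m, p).

Hypothesis K0 : (0 < K)%N.
Hypothesis lam01 : 0 <= lam < 1.
Hypothesis L0 : 0 <= L.
Hypothesis W_col : forall j, \sum_i W i j = 1.
Hypothesis W_row : forall i, \sum_j W i j = 1.
Hypothesis W_contr : forall A : 'M[R]_(m, p), sqn (W *m dev A) <= lam ^+ 2 * sqn (dev A).
Hypothesis x_mix : x 1 = W *m x 0 - eta *: y 0.
Hypothesis y_mix : y 1 = W *m y 0 + g 1 - g 0.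
Hypothesis x_local : forall k, (0 < k < K)%N -> x k.+1 = x k - eta *: y k.
Hypothesis y_local : forall k, (0 < k < K)%N -> y k.+1 = y k + g k.+1 - g k.
Hypothesis mean_yg0 : mean (y 0) = mean (g 0).
Hypothesis h_lip : forall k, sqn (h k - h 0) <= L ^+ 2 * sqn (x k - x 0).

Let kappa : R := K%:R.
Let X k := sqn (dev (x k)).
Let Y k := sqn (dev (y k)).
Let U k := C1 lam K * eta ^+ 2 * Y k.
Let N k := sqn (g k - h k).
Let H := \sum_(k < K) sqn (mean (h k)).
Let Ns := \sum_(k < K.+1) N k.
Let mu := 1 - lam.
Let ep := eta ^+ 2 * kappa ^+ 2 * L ^+ 2.

Lemma y_closed k : (0 < k <= K)%N -> y k = W *m y 0 + g k - g 0.
Proof.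
elim: k => [//|[|k] IH] /andP[_ kK]; first exact: y_mix.
rewrite y_local // IH ?(ltnW kK) //.
by apply/matrixP => i j; rewrite !mxE; ring.
Qed.

(** The first step uses [y 0] before mixing, the k later ones use W y_0 + g_l - g_0. Since
    deviations shrink by lambda under [W], the trackers contribute a factor 1 + lambda k. *)
Lemma x_closed k : (k < K)%N ->
  x k.+1 = W *m x 0 - eta *: (y 0 + k%:R *: (W *m y 0))
           - eta *: \sum_(l < k) (g l.+1 - g 0).
Proof.
elim: k => [|k IH] kK.
  by rewrite x_mix scale0r addr0 big_ord0 scaler0 subr0.
rewrite x_local // IH ?(ltnW kK) // (@y_closed k.+1) ?(ltnW kK) // big_ord_recr /= -natr1.
by apply/matrixP => i j; rewrite !mxE; ring.
Qed.

Lemma mean_yg k : (k <= K)%N -> mean (y k) = mean (g k).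
Proof.
case: k => [//|k] kK; rewrite (@y_closed k.+1) // meanB meanD mean_mulmx // mean_yg0.
by rewrite addrAC subrr add0r.
Qed.

Lemma mean_x k : (k <= K)%N -> mean (x k) = mean (x 0) - eta *: \sum_(l < k) mean (g l).
Proof.
elim: k => [|k IH] kK; first by rewrite big_ord0 scaler0 subr0.
rewrite big_ord_recr /= scalerDr opprD addrA -IH ?(ltnW kK) //.
case: k {IH} kK => [|k] kK; first by rewrite x_mix meanB mean_mulmx // meanZ mean_yg0.
by rewrite x_local // meanB meanZ mean_yg // ltnW.
Qed.

(** By Pythagoras the displacement is a dispersion part plus the displacement of the mean, a sum of
    mean stochastic gradients. Their exact parts remain as [H], for the descent inequality to
    absorb. *)
Lemma round_drift k : (k <= K)%N ->
  sqn (x k - x 0) <= 2 * (X k + X 0) + 2 * eta ^+ 2 * kappa * (m%:R * H + Ns).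
Proof.
move=> kK; rewrite sqn_dev_mean devB meanB mean_x //.
rewrite lerD //; first by rewrite mulrDr sqnB2.
rewrite addrAC subrr add0r sqnN sqnZ.
have hs : sqn (\sum_(l < k) mean (g l)) <= kappa * \sum_(l < K) sqn (mean (g l)).
  apply: (le_trans (sqn_sum_le _)); apply: ler_pM; rewrite ?ler0n ?ler_nat //.
    by apply: sumr_ge0 => l _; exact: sqn_ge0.
  rewrite (big_ord_widen _ (fun l => sqn (mean (g l))) kK) [leRHS](bigID (fun l : 'I_K => (l < k)%N)) /=.
  by rewrite lerDl sumr_ge0 // => l _; exact: sqn_ge0.
have hg : m%:R * \sum_(l < K) sqn (mean (g l)) <= 2 * (m%:R * H + Ns).
  rewrite /Ns big_ord_recr /= /H mulr_sumr.
  apply: (@le_trans _ _ (2 * (m%:R * \sum_(l < K) sqn (mean (h l)) + \sum_(l < K) N l))); last first.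
    by rewrite ler_wpM2l // addrA lerDl sqn_ge0.
  rewrite mulr_sumr -big_split mulr_sumr; apply: ler_sum => l _ /=.
  have -> : mean (g l) = mean (h l) + mean (g l - h l) by rewrite -meanD addrC subrK.
  have := ler_wpM2l (ler0n R m) (sqnD2 (mean (h l)) (mean (g l - h l))).
  by have := sqn_mean_le (g l - h l); rewrite /N; nra.
have step : m%:R * sqn (\sum_(l < k) mean (g l)) <= kappa * (2 * (m%:R * H + Ns)).
  apply: (le_trans (ler_wpM2l (ler0n R m) hs)).
  by rewrite mulrCA ler_wpM2l // ler0n.
have := ler_wpM2l (sqr_ge0 eta) step.
lra.
Qed.

Lemma round_grad_drift k : (k <= K)%N ->
  sqn (g k - g 0) <= 4 * L ^+ 2 * (X k + X 0)
    + 4 * L ^+ 2 * eta ^+ 2 * kappa * (m%:R * H + Ns) + 4 * (N k + N 0).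
Proof.
move=> kK.
have -> : g k - g 0 = (h k - h 0) + ((g k - h k) - (g 0 - h 0)).
  by apply/matrixP => i j; rewrite !mxE; ring.
apply: (le_trans (sqnD2 _ _)).
have := sqnB2 (g k - h k) (g 0 - h 0); rewrite -/(N k) -/(N 0).
have := h_lip k; have := ler_wpM2l (sqr_ge0 L) (round_drift kK).
nra.
Qed.

Let mu_gt0 : 0 < mu. Proof. by rewrite subr_gt0; case/andP: lam01. Qed.
Let lam_ge0 : 0 <= lam. Proof. by case/andP: lam01. Qed.

(** [E] is the gradient drift entering the iterates of the round: at most K - 1 differences occur in
    [x_closed]. [Q] bounds the dispersion at every step after the mixing. *)
Let E := eta ^+ 2 * kappa * \sum_(l < K.-1) sqn (g l.+1 - g 0).
Let Q := lam * X 0 + mu / 3 * U 0 + 2 / mu * E.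

Lemma one_plus_le k : (k < K)%N -> 0 <= 1 + lam * k%:R <= 1 + lam * kappa - lam.
Proof.
move=> kK; rewrite addr_ge0 ?mulr_ge0 ?ler0n //= -addrA lerD2l.
rewrite -[X in _ - X]mulr1 -mulrBr ler_wpM2l // lerBrDr natr1 /kappa ler_nat //.
Qed.

(** The shape of [C1] comes from here. The trackers add eta^2 (1 + lambda k)^2 Y_0; one factor is at
    most 1 + lambda K - lambda, the other at most K, and the 6/mu^2 in [C1] turns the product into
    mu^2/6 U_0. Young's weight 1/mu then yields mu/3 U_0. *)
Lemma round_dispersion k : (k < K)%N -> X k.+1 <= Q.
Proof.
move=> kK; rewrite /X x_closed // -addrA devD dev_mulmx //.
apply: (le_trans (sqnD_contraction _ lam01 (W_contr _))); rewrite -/(X 0) -/mu.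
rewrite /Q -addrA lerD2l -opprD -scaleN1r devZ sqnZ sqrrN expr1n mul1r devD.
apply: (@le_trans _ _ (mu^-1 * (2 * (mu ^+ 2 / 6 * U 0) + 2 * E))); last first.
  rewrite le_eqVlt; apply/orP; left; apply/eqP.
  by field; rewrite gt_eqF.
rewrite ler_wpM2l ?invr_ge0 ?(ltW mu_gt0) //; apply: (le_trans (sqnD2 _ _)).
rewrite lerD // ler_wpM2l //.
  rewrite devZ sqnZ devD devZ dev_mulmx //.
  have h1 := sqnD_scale lam01 (ler0n R k) (W_contr (y 0)).
  apply: (le_trans (ler_wpM2l (sqr_ge0 _) h1)).
  have /andP[a0 a1] := one_plus_le kK.
  have a2 : 1 + lam * kappa - lam <= kappa.
    have : 1 <= kappa by rewrite /kappa ler1n.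
    have : lam <= 1 by case/andP: lam01 => _ /ltW.
    by nra.
  have -> : mu ^+ 2 / 6 * U 0 = eta ^+ 2 * ((1 + lam * kappa - lam) * kappa * Y 0).
    by rewrite /U /C1 -/kappa -/mu; field; rewrite gt_eqF.
  rewrite ler_wpM2l ?sqr_ge0 // ler_wpM2r ?sqn_ge0 // expr2 ler_pM //.
  exact: le_trans a1 a2.
rewrite devZ sqnZ /E -mulrA ler_wpM2l ?sqr_ge0 //.
apply: (le_trans (sqn_dev_le _)).
apply: (le_trans (sqn_sum_le _)); apply: ler_pM; rewrite ?ler0n ?ler_nat ?(ltnW kK) //.
  by apply: sumr_ge0 => l _; exact: sqn_ge0.
have kK' : (k <= K.-1)%N by rewrite -ltnS prednK.
rewrite (big_ord_widen _ (fun l => sqn (g l.+1 - g 0)) kK').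
rewrite [leRHS](bigID (fun l : 'I_K.-1 => (l < k)%N)) /=.
by rewrite lerDl sumr_ge0 // => l _; exact: sqn_ge0.
Qed.

Let E_ge0 : 0 <= E.
Proof.
rewrite /E; apply: mulr_ge0; last by apply: sumr_ge0 => l _; exact: sqn_ge0.
by apply: mulr_ge0; [exact: sqr_ge0 | exact: ler0n].
Qed.

(** The sum of [R0 / 4] and [G] of the next proof. The noises at both ends carry an extra factor K:
    that of g_0 recurs in every gradient difference, and the tracker change g_K - g_0 is weighted by
    [C1], of order K^2. *)
Definition round_error : R :=
  eta ^+ 2 * kappa * (2 * (ep * (m%:R * H)) + 3 * Ns + kappa * (2 * N 0 + N K)).

(** The second bound refers all dispersions inside the round to its start; these are the dispersions
    that appear in the descent of the objective. *)
Theorem round_contraction : 576 * ep <= mu ^+ 4 ->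
  X K + U K <= (1 - mu / 2) * (X 0 + U 0) + 24 / mu ^+ 3 * round_error /\
  \sum_(k < K) X k <= kappa * (3 * (X 0 + U 0) + 16 / mu * round_error).
Proof.
move=> hep.
have k1 : 1 <= kappa by rewrite /kappa ler1n.
have ep0 : 0 <= ep by rewrite /ep; do 2!apply: mulr_ge0 => //; exact: sqr_ge0.
have mu1 : mu <= 1 by rewrite /mu lerBlDr lerDl.
have ep1 : ep <= 1.
  have : mu ^+ 4 <= 1 by rewrite exprn_ile1 // ltW.
  by lra.
have Y0 k : 0 <= Y k by exact: sqn_ge0.
have X0 k : 0 <= X k by exact: sqn_ge0.
have N0 k : 0 <= N k by exact: sqn_ge0.
have H0 : 0 <= H by apply: sumr_ge0 => l _; exact: sqn_ge0.
have mH0 : 0 <= m%:R * H by rewrite mulr_ge0 ?ler0n.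
have Ns0 : 0 <= Ns by apply: sumr_ge0.
have e2 : 0 <= eta ^+ 2 by exact: sqr_ge0.
have C10 : 0 <= C1 lam K.
  have /andP[] := one_plus_le K0; rewrite mulr0 addr0 -/kappa => _ c.
  by rewrite /C1 divr_ge0 ?sqr_ge0 // !mulr_ge0 ?ler0n // (le_trans _ c).
have U0 k : 0 <= U k by rewrite /U; do 2!apply: mulr_ge0 => //.
have kappa0 : 0 <= kappa by rewrite ler0n.
(* [Ns] counts twice: the noise enters each gradient difference directly and also through the motion
   of the mean, there with the factor ep <= 1. *)
pose R0 := 4 * (eta ^+ 2 * kappa) * (ep * (m%:R * H) + 2 * Ns + kappa * N 0).
have ek0 : 0 <= eta ^+ 2 * kappa by rewrite mulr_ge0 // ler0n.
have R00 : 0 <= R0.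
  by rewrite /R0; apply: mulr_ge0; [exact: mulr_ge0 | rewrite !addr_ge0 // mulr_ge0].
have epNs : ep * Ns <= Ns by rewrite ler_piMl.
have Q0 : 0 <= Q by apply: le_trans (round_dispersion K0).
have hE : E <= 4 * ep * (Q + X 0) + R0.
  have -> : 4 * ep * (Q + X 0) + R0 = eta ^+ 2 * kappa *
    (kappa * (4 * L ^+ 2 * (Q + X 0)) + 4 * (ep * (m%:R * H) + 2 * Ns + kappa * N 0)).
    by rewrite /R0 /ep; ring.
  rewrite /E ler_wpM2l //.
  apply: (@le_trans _ _ (\sum_(l < K.-1) (4 * L ^+ 2 * (Q + X 0)
     + 4 * L ^+ 2 * eta ^+ 2 * kappa * (m%:R * H + Ns) + 4 * (N l.+1 + N 0)))).
    apply: ler_sum => l _.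
    have lK : (l.+1 < K)%N by rewrite -[ltnRHS](prednK K0) ltnS.
    apply: (le_trans (round_grad_drift (ltnW lK))).
    rewrite !lerD2r ler_wpM2l ?(mulr_ge0 _ (sqr_ge0 _)) // lerD2r.
    exact: round_dispersion (ltnW lK).
  rewrite big_split sumr_const /= card_ord -[_ *+ K.-1]mulr_natl -mulr_sumr big_split /=.
  rewrite sumr_const card_ord -[N 0 *+ _]mulr_natl.
  set kp := K.-1%:R.
  have kp0 : 0 <= kp by rewrite ler0n.
  have kpk : kp <= kappa by rewrite ler_nat leq_pred.
  have sN : \sum_(l < K.-1) N l.+1 <= Ns.
    rewrite /Ns -(prednK K0) big_ord_recl big_ord_recr /=.
    by rewrite addrCA lerDl addr_ge0.
  have a0 : 0 <= 4 * L ^+ 2 * (Q + X 0) + 4 * L ^+ 2 * eta ^+ 2 * kappa * (m%:R * H + Ns).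
    have L2 : 0 <= 4 * L ^+ 2 by apply: mulr_ge0 => //; exact: sqr_ge0.
    apply: addr_ge0; first by apply: mulr_ge0 => //; exact: addr_ge0.
    apply: mulr_ge0; last exact: addr_ge0.
    by do 2!apply: mulr_ge0 => //.
  have s1 := ler_wpM2r a0 kpk.
  have s2 := ler_wpM2r (N0 0) kpk.
  apply: (le_trans (lerD s1 (ler_wpM2l _ (lerD sN s2)))) => //.
  have -> : kappa * (4 * L ^+ 2 * (Q + X 0) + 4 * L ^+ 2 * eta ^+ 2 * kappa * (m%:R * H + Ns))
   = kappa * (4 * L ^+ 2 * (Q + X 0)) + 4 * (ep * (m%:R * H) + ep * Ns) by rewrite /ep; ring.
  lra.
have hE' := round_drift_bound erefl lam_ge0 mu_gt0 ep0 hep (X0 0) (U0 0) E_ge0 erefl hE.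
have hXK : X K <= Q by have := @round_dispersion K.-1; rewrite prednK //; apply.
(* Normalised so that 24/mu^3 [DK] is the bound 6 K^2/mu^2 on [C1], times eta^2, times Young's
   weight 1/mu on |g_K - g_0|^2. *)
pose DK := kappa ^+ 2 * eta ^+ 2 / 4 * sqn (g K - g 0).
pose G := eta ^+ 2 * kappa * (ep * (m%:R * H) + Ns + kappa * (N K + N 0)).
have hUK : U K <= lam * U 0 + 24 / mu ^+ 3 * DK.
  have YK : Y K <= lam * Y 0 + mu^-1 * sqn (g K - g 0).
    rewrite /Y (@y_closed K) ?K0 ?leqnn // -[_ + g K - _]addrA devD dev_mulmx //.
    apply: (le_trans (sqnD_contraction _ lam01 (W_contr _))); rewrite lerD2l.
    by rewrite ler_wpM2l ?invr_ge0 ?(ltW mu_gt0) ?sqn_dev_le.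
  have Cb : C1 lam K <= 6 * kappa ^+ 2 / mu ^+ 2.
    rewrite /C1 ler_wpM2r ?invr_ge0 ?sqr_ge0 // expr2 mulrA ler_wpM2r ?ler0n //.
    rewrite ler_wpM2l //.
    have : lam <= 1 by case/andP: lam01 => _ /ltW.
    by rewrite -/kappa; nra.
  rewrite /U; apply: (le_trans (ler_wpM2l _ YK)); first by rewrite mulr_ge0.
  rewrite mulrDr [_ * (lam * _)]mulrCA lerD2l.
  have -> : 24 / mu ^+ 3 * DK = (6 * kappa ^+ 2 / mu ^+ 2) * eta ^+ 2 * (mu^-1 * sqn (g K - g 0)).
    by rewrite /DK; field; rewrite gt_eqF.
  rewrite ler_wpM2r ?mulr_ge0 ?invr_ge0 ?sqn_ge0 ?(ltW mu_gt0) //.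
  by rewrite ler_wpM2r.
have hDK : DK <= ep * (Q + X 0) + G.
  have c0 : 0 <= kappa ^+ 2 * eta ^+ 2 / 4.
    by apply: divr_ge0 => //; apply: mulr_ge0 => //; exact: sqr_ge0.
  apply: (le_trans (ler_wpM2l c0 (round_grad_drift (leqnn K)))).
  have -> : kappa ^+ 2 * eta ^+ 2 / 4 * (4 * L ^+ 2 * (X K + X 0) +
     4 * L ^+ 2 * eta ^+ 2 * kappa * (m%:R * H + Ns) + 4 * (N K + N 0)) =
     ep * (X K + X 0) + eta ^+ 2 * kappa * (ep * (m%:R * H) + ep * Ns + kappa * (N K + N 0)).
    by rewrite /ep; field.
  rewrite lerD // ler_wpM2l //; first by rewrite lerD2r.
  by rewrite lerD2r lerD2l.
have [c1 c2] := round_contraction_arith erefl lam_ge0 mu_gt0 ep0 hep (X0 0) (U0 0) E_ge0 R00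
  erefl hE' hXK hUK hDK.
have -> : round_error = R0 / 4 + G by rewrite /round_error /R0 /G; field.
split => //.
have G0 : 0 <= G.
  rewrite /G; apply: mulr_ge0 => //.
  by apply: addr_ge0; [apply: addr_ge0 => //; exact: mulr_ge0 | apply: mulr_ge0 => //; exact: addr_ge0].
(* Step 0 precedes the mixing and is covered by [X 0], all later ones by [Q]. *)
have sX : \sum_(k < K) X k <= \sum_(k < K) (X 0 + Q).
  apply: ler_sum => -[[|k] kK] _ /=; first by rewrite lerDl.
  by apply: (le_trans (round_dispersion (ltnW kK))); rewrite lerDr.
apply: (le_trans sX); rewrite sumr_const card_ord -[_ *+ K]mulr_natl ler_wpM2l ?ler0n //.
apply: (le_trans c2); rewrite lerD2l.
have -> : 16 / mu * (R0 / 4 + G) = 4 / mu * R0 + 16 / mu * G by field; rewrite gt_eqF.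
by rewrite lerDl; apply: mulr_ge0 => //; apply: divr_ge0 => //; exact: ltW.
Qed.
End Round.

(** * Descent of the mean objective *)

Section Smooth.
Variables (R : realType) (p : nat).
Implicit Types (u v w x : 'rV[R]_p) (f : 'rV[R]_p -> R).

Definition edot u v : R := \sum_j u 0 j * v 0 j.

Lemma sqn_row u : sqn u = \sum_j u 0 j ^+ 2.
Proof. by rewrite /sqn big_ord1. Qed.

Lemma enorm_sqr u : enorm u ^+ 2 = sqn u.
Proof. by rewrite /enorm sqn_row sqr_sqrtr // sumr_ge0 // => j _; exact: sqr_ge0. Qed.

Lemma edotDl u v w : edot (u + v) w = edot u w + edot v w.
Proof. by rewrite /edot -big_split; apply: eq_bigr => j _; rewrite mxE mulrDl. Qed.

Lemma edotDr u v w : edot u (v + w) = edot u v + edot u w.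
Proof. by rewrite /edot -big_split; apply: eq_bigr => j _; rewrite mxE mulrDr. Qed.

Lemma edotZl a u v : edot (a *: u) v = a * edot u v.
Proof. by rewrite /edot mulr_sumr; apply: eq_bigr => j _; rewrite mxE mulrA. Qed.

Lemma edotZr a u v : edot u (a *: v) = a * edot u v.
Proof. by rewrite /edot mulr_sumr; apply: eq_bigr => j _; rewrite mxE mulrCA. Qed.

Lemma edotNl u v : edot (- u) v = - edot u v.
Proof. by rewrite -scaleN1r edotZl mulN1r. Qed.

Lemma edotNr u v : edot u (- v) = - edot u v.
Proof. by rewrite -scaleN1r edotZr mulN1r. Qed.

Lemma edotvv u : edot u u = sqn u.
Proof. by rewrite sqn_row; apply: eq_bigr => j _; rewrite expr2. Qed.

Lemma edotC u v : edot u v = edot v u.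
Proof. by apply: eq_bigr => j _; rewrite mulrC. Qed.

Lemma sqnB_edot u v : sqn (u - v) = sqn u - 2 * edot u v + sqn v.
Proof. by rewrite -!edotvv !(edotDl, edotDr, edotNl, edotNr) (edotC v u); ring. Qed.

Lemma edot_young (t : R) u v : 0 < t -> 2 * edot u v <= t^-1 * sqn u + t * sqn v.
Proof.
move=> t0; have := sqn_ge0 (u - t *: v); rewrite sqnB_edot edotZr sqnZ => h.
have := ler_wpM2l (ltW (_ : 0 < t^-1)) h; rewrite invr_gt0 mulr0 => /(_ t0).
have -> : t^-1 * (sqn u - 2 * (t * edot u v) + t ^+ 2 * sqn v) =
   t^-1 * sqn u - 2 * edot u v + t * sqn v by field; rewrite gt_eqF.
lra.
Qed.

Lemma derive_grad f x v : differentiable (f : _ -> R^o) x ->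
  'D_v (f : _ -> R^o) x = edot (grad f x) v.
Proof.
move=> df; rewrite deriveE // {1}(row_sum_delta v) linear_sum.
by apply: eq_bigr => j _; rewrite linearZ /= mxE deriveE // mulrC.
Qed.

Lemma is_derive_line f x v (t : R) : differentiable (f : _ -> R^o) (x + t *: v) ->
  is_derive t 1 (fun s : R => f (x + s *: v) : R^o) (edot (grad f (x + t *: v)) v).
Proof.
move=> df; have dv := @diff_derivable _ _ _ (f : _ -> R^o) _ v df.
have E : (fun h : R => h^-1 *: (((fun s : R => f (x + s *: v) : R^o) \o shift t) (h *: (1 : R^o)) - f (x + t *: v)))
   = (fun h : R => h^-1 *: (((f : _ -> R^o) \o shift (x + t *: v)) (h *: v) - f (x + t *: v))).
  apply/funext => h /=; congr (_ *: (f _ - _)).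
  by rewrite [h *: (1 : R^o)]mulr1 scalerDl addrCA.
apply: DeriveDef; first by rewrite /derivable E.
by rewrite -derive_grad // /derive E.
Qed.

(** Subtracting the linear and quadratic terms along the segment leaves a function [phi] with
    nonpositive derivative inside it; the mean value theorem then replaces integration of the
    gradient. *)
Lemma descent_upper f (L : R) x v : 0 < L ->
  (forall z, differentiable (f : _ -> R^o) z) ->
  (forall z1 z2, sqn (grad f z1 - grad f z2) <= L ^+ 2 * sqn (z1 - z2)) ->
  f (x + v) <= f x + edot (grad f x) v + L / 2 * sqn v.
Proof.
move=> L0 df lip.
pose phi : R -> R^o := fun t => f (x + t *: v) - (edot (grad f x) v * t + L / 2 * sqn v * t ^+ 2).
pose dphi : R -> R := fun t => edot (grad f (x + t *: v)) v - (edot (grad f x) v + L * sqn v * t).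
have isd (t : R) : is_derive t 1 phi (dphi t).
  have h1 := is_derive_line (df (x + t *: v)).
  have h2 : is_derive t 1 (fun t : R => edot (grad f x) v * t + L / 2 * sqn v * t ^+ 2 : R^o)
     (edot (grad f x) v + L * sqn v * t).
    apply: is_derive_eq.
    by rewrite /GRing.scale /=; field.
  exact: is_deriveB.
have [|c] := @MVT R phi dphi 0 1 ltr01 (fun t _ => isd t).
  apply: continuous_subspaceT => t; apply: differentiable_continuous.
  by apply/derivable1_diffP; case: (isd t).
rewrite in_itv /= => /andP[c0 c1]; rewrite subr0 mulr1 /phi scale1r scale0r addr0 => E.
have : dphi c <= 0.
  (* With the weight c L both halves of Young's bound are at most c L |v|^2, by the Lipschitz
     condition. *)
  have hy := edot_young (grad f (x + c *: v) - grad f x) v (mulr_gt0 c0 L0).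
  have hl := lip (x + c *: v) x; rewrite addrAC subrr add0r sqnZ in hl.
  rewrite edotDl edotNl in hy.
  have : (c * L)^-1 * sqn (grad f (x + c *: v) - grad f x) <= c * L * sqn v.
    rewrite ler_pdivrMl ?mulr_gt0 //; apply: (le_trans hl).
    by rewrite le_eqVlt; apply/orP; left; apply/eqP; ring.
  by rewrite /dphi; lra.
move: E; rewrite expr1n expr0n /= !mulr1 !mulr0 addr0 subr0; lra.
Qed.

Lemma gradN f x : differentiable (f : _ -> R^o) x -> grad (fun z => - f z) x = - grad f x.
Proof.
move=> df; apply/rowP => j; rewrite !mxE.
by rewrite (@deriveN _ _ _ (f : _ -> R^o)) //; exact: diff_derivable.
Qed.

(** The lower half is the upper one for -f. Together they bound |f| by a quadratic, which later
    makes the objective integrable along the iterates. *)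
Lemma descent f (L : R) x v : 0 < L ->
  (forall z, differentiable (f : _ -> R^o) z) ->
  (forall z1 z2, sqn (grad f z1 - grad f z2) <= L ^+ 2 * sqn (z1 - z2)) ->
  `|f (x + v) - f x - edot (grad f x) v| <= L / 2 * sqn v.
Proof.
move=> L0 df lip; rewrite ler_norml; apply/andP; split; last first.
  by have := descent_upper x v L0 df lip; lra.
have := @descent_upper (fun z => - f z) L x v L0; rewrite gradN // edotNl.
have dN z : differentiable ((fun z => - f z) : _ -> R^o) z by exact: differentiableN.
move=> /(_ dN) h; have := h _; rewrite -/(_ -> _) => {}h.
suff /h : forall z1 z2, sqn (grad (fun z => - f z) z1 - grad (fun z => - f z) z2) <= L ^+ 2 * sqn (z1 - z2) by lra.
by move=> z1 z2; rewrite !gradN // -opprD sqnN.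
Qed.

End Smooth.

Lemma C1_ge0 (R : realType) (lam : R) K : (0 < K)%N -> 0 <= lam -> 0 <= C1 lam K.
Proof.
move=> K0 l0; rewrite /C1 divr_ge0 ?sqr_ge0 //; apply: mulr_ge0; last exact: ler0n.
apply: mulr_ge0 => //; have : 1 <= K%:R :> R by rewrite ler1n.
by move/(ler_wpM2l l0); lra.
Qed.

(** Three cancellations. The dispersions of the gap and of the descent inequality add up to eta
    L^2/m [Xs], paid for by the decrease mu/2 [V0] of the weighted V. The exact-gradient part of
    [RE] is absorbed by -eta/4 [Hs]. What remains is [M] and the noise [Nz]. *)
Lemma progress_arith (R : realFieldType) (mu kappa mr eta L F0 F1 G Xs Hs M V0 VK RE Nz ep : R) :
  0 < mu <= 1 -> 0 < kappa -> 1 <= mr -> 0 < eta <= 1 ->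
  0 <= V0 -> 0 <= Hs -> 0 <= Nz -> ep = eta ^+ 2 * kappa ^+ 2 * L ^+ 2 ->
  576 * ep <= mu ^+ 4 -> 6 * eta * L ^+ 2 * kappa ^+ 2 * mr <= mu ->
  F1 <= F0 - eta / 2 * G + eta * L ^+ 2 / (2 * mr) * Xs - eta / 4 * Hs + M ->
  VK <= (1 - mu / 2) * V0 + 24 / mu ^+ 3 * RE ->
  Xs <= kappa * (3 * V0 + 16 / mu * RE) ->
  RE = eta ^+ 2 * kappa * (2 * (ep * (mr * Hs)) + Nz) ->
  eta / 2 * (G + L ^+ 2 / mr * Xs) <=
    F0 + (mr ^+ 2 * kappa)^-1 * V0 - (F1 + (mr ^+ 2 * kappa)^-1 * VK) + M
    + 30 * eta ^+ 2 / (mu ^+ 3 * mr ^+ 2) * Nz.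
Proof.
move=> /andP[mu0 mu1] k0 mr1 /andP[e0 e1] V00 H0 N0 epE hep hX hF hV hXs REE.
have mr0 : 0 < mr by lra.
pose w := (mr ^+ 2 * kappa)^-1.
have w0 : 0 < w by rewrite invr_gt0 mulr_gt0 // exprn_gt0.
have ep0 : 0 <= ep by rewrite epE -!exprMn sqr_ge0.
pose i := mu^-1.
have i0 : 0 < i by rewrite invr_gt0.
have i1 : 1 <= i by rewrite invf_ge1.
have mui : mu * i = 1 by rewrite mulfV // gt_eqF.
have i31 : 1 <= i ^+ 3 by rewrite exprn_ege1.
have RE0 : 0 <= RE.
  rewrite REE; apply: mulr_ge0; first by apply: mulr_ge0; [exact: sqr_ge0|exact: ltW].
  by apply: addr_ge0 => //; do 2!apply: mulr_ge0 => //; apply: mulr_ge0 => //; exact: ltW.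
have a1 : eta * L ^+ 2 / mr * Xs <= w * (mu / 2 * V0 + 3 * RE).
  have c0 : 0 <= eta * L ^+ 2 / mr.
    by apply: divr_ge0; [apply: mulr_ge0; [exact: ltW|exact: sqr_ge0]|exact: ltW].
  apply: (le_trans (ler_wpM2l c0 hXs)).
  have -> : eta * L ^+ 2 / mr * (kappa * (3 * V0 + 16 / mu * RE)) =
     w * ((6 * eta * L ^+ 2 * kappa ^+ 2 * mr) * (V0 / 2 + 8 / 3 * (i * RE))).
    by rewrite /w /i; field; rewrite !gt_eqF.
  apply: ler_wpM2l; first exact: ltW.
  have b0 : 0 <= V0 / 2 + 8 / 3 * (i * RE).
    by have := mulr_ge0 (ltW i0) RE0; lra.
  apply: (le_trans (ler_wpM2r b0 hX)).
  have -> : mu * (V0 / 2 + 8 / 3 * (i * RE)) = mu * V0 / 2 + 8 / 3 * ((mu * i) * RE) by ring.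
  by rewrite mui; lra.
have a2 : w * VK <= w * ((1 - mu / 2) * V0 + 24 * i ^+ 3 * RE).
  by rewrite ler_wpM2l ?(ltW w0) // /i exprVn.
(* 27 = 24 + 3: the errors from the contraction and from the dispersion sum. *)
have a3 : 27 * w * i ^+ 3 * RE <= eta / 4 * Hs + 30 * eta ^+ 2 / (mu ^+ 3 * mr ^+ 2) * Nz.
  have -> : 27 * w * i ^+ 3 * RE = (54 * eta * (ep * i ^+ 3) / mr) * (eta * Hs)
      + 27 * eta ^+ 2 / (mu ^+ 3 * mr ^+ 2) * Nz.
    by rewrite REE /w /i; field; rewrite !gt_eqF.
  have c1 : 216 * (ep * i ^+ 3) <= 1.
    have h := ler_wpM2r (exprn_ge0 3 (ltW i0)) hep.
    have e4 : mu ^+ 4 * i ^+ 3 = mu by rewrite exprSr mulrAC -exprMn mui expr1n mul1r.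
    have := mulr_ge0 ep0 (exprn_ge0 3 (ltW i0)).
    rewrite e4 in h; lra.
  have c2 : 54 * eta * (ep * i ^+ 3) / mr <= 1 / 4.
    rewrite ler_pdivrMr //.
    have p0 := mulr_ge0 ep0 (exprn_ge0 3 (ltW i0)).
    have := ler_wpM2r p0 e1; lra.
  apply: lerD.
    have := ler_wpM2r (mulr_ge0 (ltW e0) H0) c2; lra.
  rewrite ler_wpM2r // ler_wpM2r ?invr_ge0 ?mulr_ge0 ?exprn_ge0 ?(ltW mu0) ?(ltW mr0) //.
  by rewrite ler_wpM2r ?sqr_ge0 // ler_nat.
have a4 : w * RE <= w * RE * i ^+ 3 by rewrite ler_peMr // mulr_ge0 // ltW.
have -> : eta / 2 * (G + L ^+ 2 / mr * Xs) = eta / 2 * G + eta * L ^+ 2 / mr * Xs / 2.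
  by field; rewrite gt_eqF.
have e5 : eta * L ^+ 2 / (2 * mr) * Xs = eta * L ^+ 2 / mr * Xs / 2 by field; rewrite gt_eqF.
rewrite e5 in hF; rewrite -/w; lra.
Qed.

Lemma telescope_arith (R : realFieldType) (e c A a P0 P1 P2 B b N n : R) :
  e * A <= P0 - P1 + B + c * N -> e * a <= P1 - P2 + b + c * n ->
  e * (A + a) <= P0 - P2 + (B + b) + c * (N + n).
Proof. lra. Qed.

(** * The mean objective along the iterates *)

Section MeanObjective.
Variables (R : realType) (m p : nat) (fi : 'I_m -> 'rV[R]_p -> R) (L : R).
Hypothesis m0 : (0 < m)%N.
Hypothesis L0 : 0 < L.
Hypothesis fi_diff : forall i x, differentiable (fi i : _ -> R^o) x.
Hypothesis fi_lip : forall i x1 x2,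
  sqn (grad (fi i) x1 - grad (fi i) x2) <= L ^+ 2 * sqn (x1 - x2).

Definition mean_fun (x : 'rV[R]_p) : R := m%:R^-1 * \sum_(i < m) fi i x.

Definition local_grads (A : 'M[R]_(m, p)) : 'M[R]_(m, p) :=
  \matrix_i grad (fi i) (row i A).

Let mR0 : 0 < m%:R :> R. Proof. by rewrite ltr0n. Qed.

Lemma mean_fun_diff x : differentiable (mean_fun : _ -> R^o) x.
Proof.
have -> : (mean_fun : _ -> R^o) = m%:R^-1 \*: \sum_(i < m) (fi i : _ -> R^o).
  by apply/funext => z; rewrite /mean_fun /= fct_sumE.
by apply: differentiableZ; apply: differentiable_sum.
Qed.

Lemma grad_mean_fun x : grad mean_fun x = mean (\matrix_i grad (fi i) x).
Proof.
apply/rowP => j; rewrite /mean !mxE.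
have -> : (mean_fun : _ -> R^o) = m%:R^-1 \*: \sum_(i < m) (fi i : _ -> R^o).
  by apply/funext => z; rewrite /mean_fun /= fct_sumE.
have df i : derivable (fi i : _ -> R^o) x (delta_mx 0 j) by exact: diff_derivable.
rewrite deriveZ; last exact: derivable_sum.
rewrite derive_sum // summxE; congr (_ * _).
by apply: eq_bigr => i _; rewrite !mxE.
Qed.

Lemma sqn_rows k (A : 'M[R]_(k, p)) : sqn A = \sum_i sqn (row i A).
Proof.
by apply: eq_bigr => i _; rewrite sqn_row; apply: eq_bigr => j _; rewrite mxE.
Qed.

Lemma local_grads_lip A B :
  sqn (local_grads A - local_grads B) <= L ^+ 2 * sqn (A - B).
Proof.
rewrite !sqn_rows mulr_sumr; apply: ler_sum => i _.
by rewrite !linearB /= !rowK fi_lip.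
Qed.

Lemma sqn_grad_mean_fun_mean A :
  sqn (grad mean_fun (mean A) - mean (local_grads A)) <= L ^+ 2 / m%:R * sqn (dev A).
Proof.
rewrite grad_mean_fun -meanB -mulrA mulrCA -ler_pdivrMl ?invr_gt0 // invrK.
apply: (le_trans (sqn_mean_le _)); rewrite !sqn_rows mulr_sumr; apply: ler_sum => i _.
rewrite linearB /= !rowK; apply: (le_trans (fi_lip _ _ _)).
by rewrite -sqnN opprB /dev linearB /= rowK.
Qed.

Lemma grad_mean_fun_lip x1 x2 :
  sqn (grad mean_fun x1 - grad mean_fun x2) <= L ^+ 2 * sqn (x1 - x2).
Proof.
rewrite !grad_mean_fun -meanB -(ler_pM2l mR0).
apply: (le_trans (sqn_mean_le _)); rewrite sqn_rows.
apply: (@le_trans _ _ (\sum_(i < m) L ^+ 2 * sqn (x1 - x2))).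
  by apply: ler_sum => i _; rewrite linearB /= !rowK fi_lip.
by rewrite sumr_const card_ord mulr_natl.
Qed.

(** Polarising the product of the true gradient with the mean local gradient produces both negative
    squares and a difference bounded by the dispersion. The noise stays as a linear term, which has
    mean zero, plus a square. *)
Lemma descent_step (eta : R) (x g : 'M[R]_(m, p)) : 0 < eta ->
  mean_fun (mean x - eta *: mean g) <=
    mean_fun (mean x) - eta / 2 * sqn (grad mean_fun (mean x))
    + eta * L ^+ 2 / (2 * m%:R) * sqn (dev x)
    - (eta / 2 - L * eta ^+ 2) * sqn (mean (local_grads x))
    - eta * edot (grad mean_fun (mean x)) (mean (g - local_grads x))
    + L * eta ^+ 2 * sqn (mean (g - local_grads x)).
Proof.
set df := grad mean_fun (mean x); set h := local_grads x => eta0.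
have := descent (mean x) (- (eta *: mean g)) L0 mean_fun_diff grad_mean_fun_lip.
rewrite ler_norml => /andP[_]; rewrite -/df edotNr edotZr sqnN sqnZ.
have gE : mean g = mean h + mean (g - h) by rewrite -meanD addrC subrK.
have s1 := sqnD2 (mean h) (mean (g - h)); rewrite -gE in s1.
have s2 := sqn_grad_mean_fun_mean x; rewrite -/df -/h in s2.
rewrite sqnB_edot in s2.
have -> : edot df (mean g) = edot df (mean h) + edot df (mean (g - h)).
  by rewrite -edotDr -gE.
have t1 := ler_wpM2l (ltW eta0) s2.
have t2 : 0 <= L / 2 * eta ^+ 2 by rewrite !mulr_ge0 ?sqr_ge0 ?ltW //.
have t3 := ler_wpM2l t2 s1.
have -> : eta * L ^+ 2 / (2 * m%:R) * sqn (dev x) = eta * (L ^+ 2 / m%:R * sqn (dev x)) / 2.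
  by field; rewrite gt_eqF.
lra.
Qed.

Section Flat.
Variables (K S : nat) (W : 'M[R]_m) (lam eta : R) (x y g : nat -> 'M[R]_(m, p)).
Let mu := 1 - lam.
Let kappa : R := K%:R.
Let h n := local_grads (x n).
Let X n := sqn (dev (x n)).
Let U n := C1 lam K * eta ^+ 2 * sqn (dev (y n)).
Let N n := sqn (g n - h n).
Let Df n := grad mean_fun (mean (x n)).
Let xi n := mean (g n - h n).

Hypothesis K0 : (0 < K)%N.
Hypothesis lam01 : 0 <= lam < 1.
Hypothesis W_col : forall j, \sum_i W i j = 1.
Hypothesis W_row : forall i, \sum_j W i j = 1.
Hypothesis W_contr : forall A : 'M[R]_(m, p), sqn (W *m dev A) <= lam ^+ 2 * sqn (dev A).
Hypothesis x_step : forall n, (n < S * K)%N ->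
  x n.+1 = (if (K %| n)%N then W *m x n else x n) - eta *: y n.
Hypothesis y_step : forall n, (n < S * K)%N ->
  y n.+1 = (if (K %| n)%N then W *m y n else y n) + g n.+1 - g n.
Hypothesis mean_yg0 : mean (y 0) = mean (g 0).
Hypothesis eta0 : 0 < eta.
Definition flat_potential n : R :=
  mean_fun (mean (x n)) + (m%:R ^+ 2 * K%:R)^-1 * (X n + U n).

(** The noise part of [round_error] for the round starting at step [n0], without the factor eta^2
    K. *)
Definition round_noise n0 : R :=
  3 * (\sum_(k < K.+1) N (n0 + k)) + kappa * (2 * N n0 + N (n0 + K)).

Lemma flat_mean_yg n : (n <= S * K)%N -> mean (y n) = mean (g n).
Proof.
elim: n => [|n IH] nK; first exact: mean_yg0.
rewrite (y_step nK) meanB meanD -{}IH 1?ltnW // -[RHS]add0r.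
by rewrite addrAC; congr (_ + _); case: ifP => _; rewrite ?(mean_mulmx _ W_col) subrr.
Qed.

Lemma flat_mean_x n : (n < S * K)%N -> mean (x n.+1) = mean (x n) - eta *: mean (g n).
Proof.
move=> nK; rewrite (x_step nK) meanB meanZ (flat_mean_yg (ltnW nK)).
by congr (_ - _); case: ifP => _; rewrite ?(mean_mulmx _ W_col).
Qed.

Lemma round_progress s : (s < S)%N ->
  eta <= 1 -> L * eta <= 1 / 4 ->
  576 * (eta ^+ 2 * kappa ^+ 2 * L ^+ 2) <= mu ^+ 4 ->
  6 * eta * L ^+ 2 * kappa ^+ 2 * m%:R <= mu ->
  eta / 2 * (\sum_(k < K) (sqn (Df (s * K + k)) + L ^+ 2 / m%:R * X (s * K + k)))
  <= flat_potential (s * K) - flat_potential (s.+1 * K)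
   + \sum_(k < K) (- eta * edot (Df (s * K + k)) (xi (s * K + k))
                  + L * eta ^+ 2 * sqn (xi (s * K + k)))
   + 30 * eta ^+ 2 / (mu ^+ 3 * m%:R ^+ 2) * round_noise (s * K).
Proof.
move=> sS; set n0 := (s * K)%N.
have nS k : (k < K)%N -> (n0 + k < S * K)%N.
  move=> kK; apply: (@leq_trans (s.+1 * K)); last by rewrite leq_mul2r sS orbT.
  by rewrite mulSn addnC ltn_add2r.
have mu0 : 0 < mu by rewrite subr_gt0; case/andP: lam01.
have k1 : 1 <= kappa by rewrite /kappa ler1n.
have k0 : 0 < kappa by rewrite ltr0n.
have div_local k : (0 < k < K)%N -> (K %| n0 + k)%N = false.
  move=> /andP[k0' kK]; rewrite dvdn_addr ?dvdn_mull //.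
  by apply/negP => /dvdn_leq => /(_ k0'); rewrite leqNgt kK.
have div0 : (K %| n0)%N by rewrite dvdn_mull.
have rc := @round_contraction R m p K W lam eta L
   (fun k => x (n0 + k)) (fun k => y (n0 + k)) (fun k => g (n0 + k)) (fun k => h (n0 + k))
   K0 lam01 (ltW L0) W_col W_row W_contr.
have rx1 : x (n0 + 1) = W *m x (n0 + 0) - eta *: y (n0 + 0).
  by rewrite addn0 addn1 x_step ?div0 // -[n0]addn0 nS.
have ry1 : y (n0 + 1) = W *m y (n0 + 0) + g (n0 + 1) - g (n0 + 0).
  by rewrite addn0 addn1 y_step ?div0 // -[n0]addn0 nS.
have rx k : (0 < k < K)%N -> x (n0 + k.+1) = x (n0 + k) - eta *: y (n0 + k).
  by move=> kK; rewrite addnS x_step ?div_local // nS //; case/andP: kK.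
have ry k : (0 < k < K)%N -> y (n0 + k.+1) = y (n0 + k) + g (n0 + k.+1) - g (n0 + k).
  by move=> kK; rewrite addnS y_step ?div_local // nS //; case/andP: kK.
have rm : mean (y (n0 + 0)) = mean (g (n0 + 0)).
  by rewrite addn0 flat_mean_yg // -[n0]addn0 ltnW // nS.
have rl k : sqn (h (n0 + k) - h (n0 + 0)) <= L ^+ 2 * sqn (x (n0 + k) - x (n0 + 0)).
  exact: local_grads_lip.
move: rc => /(_ rx1 ry1 rx ry rm rl) rc.
move=> eta1 etaL.
have tele : mean_fun (mean (x (n0 + K))) <= mean_fun (mean (x n0))
    - eta / 2 * \sum_(k < K) sqn (Df (n0 + k))
    + eta * L ^+ 2 / (2 * m%:R) * \sum_(k < K) X (n0 + k)
    - eta / 4 * \sum_(k < K) sqn (mean (h (n0 + k)))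
    + \sum_(k < K) (- eta * edot (Df (n0 + k)) (xi (n0 + k)) + L * eta ^+ 2 * sqn (xi (n0 + k))).
  have : forall k, (k <= K)%N -> mean_fun (mean (x (n0 + k))) <= mean_fun (mean (x n0))
    - eta / 2 * \sum_(l < k) sqn (Df (n0 + l))
    + eta * L ^+ 2 / (2 * m%:R) * \sum_(l < k) X (n0 + l)
    - eta / 4 * \sum_(l < k) sqn (mean (h (n0 + l)))
    + \sum_(l < k) (- eta * edot (Df (n0 + l)) (xi (n0 + l)) + L * eta ^+ 2 * sqn (xi (n0 + l))).
    elim=> [|k IH] kK; first by rewrite addn0 !big_ord0 !mulr0 subr0 !addr0 subr0.
    rewrite addnS flat_mean_x ?nS // !big_ord_recr /=.
    have := descent_step (x (n0 + k)) (g (n0 + k)) eta0.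
    have := IH (ltnW kK).
    rewrite -/(h _) -/(xi _) -/(X _) -/(Df _).
    (* L eta <= 1/4 keeps half of the negative square after the second-order term. *)
    have : eta / 4 * sqn (mean (h (n0 + k))) <= (eta / 2 - L * eta ^+ 2) * sqn (mean (h (n0 + k))).
      rewrite ler_wpM2r ?sqn_ge0 // expr2 mulrA.
      have := ler_wpM2r (ltW eta0) etaL; lra.
    lra.
  exact.
have -> : (s.+1 * K = n0 + K)%N by rewrite mulSn addnC.
move=> eta_ep eta_X; have [rc1 rc2] := rc eta_ep.
rewrite addn0 in rc1 rc2.
rewrite big_split /= -mulr_sumr /flat_potential.
apply: (progress_arith (ep := eta ^+ 2 * kappa ^+ 2 * L ^+ 2) _ k0 _ _ _ _ _ erefl eta_ep eta_X tele rc1 rc2).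
- by rewrite mu0 /mu lerBlDr lerDl; case/andP: lam01.
- by rewrite ler1n.
- by rewrite eta0.
- apply: addr_ge0; first exact: sqn_ge0.
  apply: mulr_ge0; last exact: sqn_ge0.
  by apply: mulr_ge0; [apply: C1_ge0 => //; case/andP: lam01 | exact: sqr_ge0].
- by apply: sumr_ge0 => k _; exact: sqn_ge0.
- apply: addr_ge0.
    by apply: mulr_ge0 => //; apply: sumr_ge0 => k _; exact: sqn_ge0.
  apply: mulr_ge0; first exact: ltW.
  by apply: addr_ge0; [apply: mulr_ge0 => //; exact: sqn_ge0 | exact: sqn_ge0].
- by rewrite /round_error /round_noise addn0 -/kappa; congr (_ * _); rewrite addrA.
Qed.

Lemma flat_progress :
  eta <= 1 -> L * eta <= 1 / 4 ->
  576 * (eta ^+ 2 * kappa ^+ 2 * L ^+ 2) <= mu ^+ 4 ->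
  6 * eta * L ^+ 2 * kappa ^+ 2 * m%:R <= mu ->
  eta / 2 * (\sum_(s < S) \sum_(k < K)
    (sqn (Df (s * K + k)) + L ^+ 2 / m%:R * X (s * K + k)))
  <= flat_potential 0 - flat_potential (S * K)
   + \sum_(s < S) \sum_(k < K) (- eta * edot (Df (s * K + k)) (xi (s * K + k))
                  + L * eta ^+ 2 * sqn (xi (s * K + k)))
   + 30 * eta ^+ 2 / (mu ^+ 3 * m%:R ^+ 2) * \sum_(s < S) round_noise (s * K).
Proof.
move=> eta1 etaL eta_ep eta_X.
suff : forall s, (s <= S)%N -> eta / 2 * (\sum_(s < s) \sum_(k < K)
    (sqn (Df (s * K + k)) + L ^+ 2 / m%:R * X (s * K + k)))
  <= flat_potential 0 - flat_potential (s * K)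
   + \sum_(s < s) \sum_(k < K) (- eta * edot (Df (s * K + k)) (xi (s * K + k))
                  + L * eta ^+ 2 * sqn (xi (s * K + k)))
   + 30 * eta ^+ 2 / (mu ^+ 3 * m%:R ^+ 2) * \sum_(s < s) round_noise (s * K) by exact.
elim=> [|s IH] sS.
  by rewrite !big_ord0 !mulr0 mul0n subrr !addr0.
rewrite !big_ord_recr /=.
exact: telescope_arith (IH (ltnW sS)) (round_progress sS eta1 etaL eta_ep eta_X).
Qed.
End Flat.
End MeanObjective.

(** * Measurability and independence *)

Section Caratheodory.
Context (R : realType) (p : nat) (d dZ : measure_display)
  (T : measurableType d) (Z : measurableType dZ).
Variables (F : 'rV[R]_p -> Z -> R) (X : T -> 'rV[R]_p) (zeta : T -> Z).
Hypothesis X_meas : forall j, measurable_fun setT (fun w => X w 0 j).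
Hypothesis zeta_meas : measurable_fun setT zeta.
Hypothesis F_meas : forall x, measurable_fun setT (F x).

(* X is approximated by rounding its coordinates down to multiples of 1/(n+1). *)
Let code (n : nat) (w : T) : {ffun 'I_p -> int} :=
  [ffun j => Num.floor (n.+1%:R * X w 0 j)].

Let grid (n : nat) (c : {ffun 'I_p -> int}) : 'rV[R]_p :=
  \row_j ((c j)%:~R / n.+1%:R).

Let code_meas n c : measurable [set w | code n w = c].
Proof.
have -> : [set w | code n w = c] =
    \bigcap_(j in [set: 'I_p]) ([set: T] `&` [set w | Num.floor (n.+1%:R * X w 0 j) = c j]).
  apply/seteqP; split => [w <- j _|w h]; first by split => //=; rewrite ffunE.
  by apply/ffunP => j; rewrite ffunE; have [] := h j I.
apply: fin_bigcap_measurable; first exact: finite_finset.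
move=> j _.
have -> : [set w | Num.floor (n.+1%:R * X w 0 j) = c j] =
    (fun w => n.+1%:R * X w 0 j) @^-1` `[(c j)%:~R, (c j + 1)%:~R[.
  apply/seteqP; split => w /=; rewrite in_itv /=.
    by move=> <-; exact: floor_itv.
  exact: floor_def.
have mf : measurable_fun setT (fun w => n.+1%:R * X w 0 j : R).
  by apply: measurable_funM => //; exact: measurable_cst.
by apply: mf => //; exact: measurable_itv.
Qed.

Let approx_meas n : measurable_fun setT (fun w => F (grid n (code n w)) (zeta w)).
Proof.
move=> _ B mB; rewrite setTI.
have -> : (fun w => F (grid n (code n w)) (zeta w)) @^-1` B =
   \bigcup_(c in [set: {ffun 'I_p -> int}])
     ([set w | code n w = c] `&` ((F (grid n c) \o zeta) @^-1` B)).
  apply/seteqP; split => [w h|w [c _ [/= <-]]//].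
  by exists (code n w).
apply: countable_bigcupT_measurable => // c.
apply: measurableI; first exact: code_meas.
rewrite -[X in measurable X]setTI; apply: measurableT_comp => //.
Qed.

(** Measurability in the sample suffices on each of the countably many events where the rounded
    point is constant; continuity in the point then gives a pointwise limit. *)
Lemma measurable_caratheodory :
  (forall z, continuous (fun x => F x z : R^o)) ->
  measurable_fun setT (fun w => F (X w) (zeta w)).
Proof.
move=> F_cont.
apply: (@measurable_fun_cvg _ _ _ _ (fun n w => F (grid n (code n w)) (zeta w))) => // w _.
apply: (@continuous_cvg _ _ _ _ _ _ (fun x => F x (zeta w) : R^o)); first exact: F_cont.
apply/cvg_ballP => e e0; near=> n; split=> // i j; rewrite ord1 !mxE ffunE.
rewrite /ball /=.
have n0 : 0 < n.+1%:R :> R by rewrite ltr0n.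
have /andP[f1 f2] := floor_itv (n.+1%:R * X w 0 j).
set k := (Num.floor _)%:~R in f1 *; rewrite intrD -/k in f2.
have en : n.+1%:R^-1 < e by near: n; exact: near_infty_natSinv_lt (PosNum e0).
apply: le_lt_trans en; rewrite ler_norml.
have -> : X w 0 j - k / n.+1%:R = (n.+1%:R * X w 0 j - k) / n.+1%:R.
  by field; rewrite gt_eqF.
rewrite ler_pdivlMr // ler_pdivrMr // mulNr mulVf ?gt_eqF //.
apply/andP; split; lra.
Unshelve. all: by end_near. Qed.
End Caratheodory.

Section SampleGradient.
Context (R : realType) (p : nat) (d dZ : measure_display)
  (T : measurableType d) (Z : measurableType dZ).

(** A partial derivative is the limit of difference quotients with steps 1/(n+1), each of which is
    measurable by the Carathéodory argument. *)
Lemma measurable_grad_comp (F : 'rV[R]_p -> Z -> R) (X : T -> 'rV[R]_p) (zeta : T -> Z) j :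
  (forall x, measurable_fun setT (F x)) ->
  (forall z x, differentiable (F^~ z : _ -> R^o) x) ->
  (forall j, measurable_fun setT (fun w => X w 0 j)) ->
  measurable_fun setT zeta ->
  measurable_fun setT (fun w => grad (F^~ (zeta w)) (X w) 0 j).
Proof.
move=> F_meas F_diff X_meas zeta_meas.
pose q n w : R := (n.+1%:R^-1)^-1 * (F (n.+1%:R^-1 *: delta_mx 0 j + X w) (zeta w) - F (X w) (zeta w)).
have F_cont z : continuous (fun x => F x z : R^o).
  by move=> x; exact: differentiable_continuous.
apply: (@measurable_fun_cvg _ _ _ _ q) => [n|w _].
  apply: measurable_funM; first exact: measurable_cst.
  apply: measurable_funB; apply: measurable_caratheodory => // k.
  under eq_fun do rewrite mxE.
  by apply: measurable_funD => //; exact: measurable_cst.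
rewrite mxE.
have dv := @diff_derivable _ _ _ (F^~ (zeta w) : _ -> R^o) _ (delta_mx 0 j) (F_diff (zeta w) (X w)).
have := (cvgr_dnbhsP (fun h : R => h^-1 *: ((F^~ (zeta w) \o shift (X w)) (h *: delta_mx 0 j)
    - F (X w) (zeta w)) : R) 0 _).1 dv (fun n => n.+1%:R^-1).
by apply; split; [move=> n; rewrite invr_eq0 pnatr_eq0 | exact: cvg_harmonic].
Qed.
End SampleGradient.

(** * Independence, product laws and fresh samples *)

Section IndependentPair.
Local Open Scope ereal_scope.
Context (R : realType) (d d1 dZ : measure_display) (T : measurableType d)
  (T1 : measurableType d1) (Z : measurableType dZ) (P : probability T R)
  (D : probability Z R) (U : {mfun T >-> T1}) (V : T -> Z).
Hypothesis V_meas : measurable_fun setT V.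
Hypothesis UV_law : forall A B, measurable A -> measurable B ->
  P (U @^-1` A `&` V @^-1` B) = P (U @^-1` A) * D B.

Let UV w := (U w, V w).

Let UV_meas : measurable_fun setT UV.
Proof. by apply: measurable_fun_pair. Qed.

Let UV_mfun : {mfun T >-> (T1 * Z)%type} := HB.pack UV (isMeasurableFun.Build _ _ _ _ _ UV_meas).

Let pair_law A : measurable A -> (distribution P U \x D) A = distribution P UV_mfun A.
Proof.
apply: product_measure_unique => B C mB mC.
by rewrite /distribution /pushforward /= -UV_law //.
Qed.

(** Agreement on rectangles makes the law of the pair a product measure; the inner integral over [D]
    then plays the role of a conditional expectation given [U]. *)
Lemma ge0_integral_pair (phi : T1 * Z -> \bar R) :
  measurable_fun setT phi -> (forall z, 0 <= phi z) ->
  \int[P]_w phi (U w, V w) = \int[distribution P U]_x \int[D]_z phi (x, z).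
Proof.
move=> mphi phi0; rewrite -[RHS]fubini_tonelli1 //.
have /= := @ge0_integral_pushforward _ _ _ _ R _ UV_meas P setT phi measurableT mphi (fun z _ => phi0 z).
rewrite preimage_setT => <-; apply: eq_measure_integral => A mA _.
exact: (esym (pair_law mA)).
Qed.

Lemma integral_pair (phi : T1 * Z -> \bar R) :
  measurable_fun setT phi -> P.-integrable setT (fun w => phi (U w, V w)) ->
  \int[P]_w phi (U w, V w) = \int[distribution P U]_x \int[D]_z phi (x, z).
Proof.
move=> mphi iphi.
have i1 : (pushforward P UV).-integrable setT phi.
  by apply: integrable_pushforward => //; rewrite preimage_setT.
have i2 : (distribution P U \x D).-integrable setT phi.
  apply/integrableP; split => //; move/integrableP: i1 => [_].
  congr (_ < _); apply: eq_measure_integral => A mA _; exact: (esym (pair_law mA)).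
rewrite (integral12_prod_meas1 i2).
have /= := @integral_pushforward _ _ _ _ R _ UV_meas P setT phi mphi.
rewrite preimage_setT => /(_ iphi measurableT) <-.
by apply: eq_measure_integral => A mA _; exact: (esym (pair_law mA)).
Qed.
End IndependentPair.

Section IndependentFamily.
Local Open Scope ereal_scope.
Context (R : realType) (d dZ : measure_display) (T : measurableType d)
  (Z : measurableType dZ) (P : probability T R) (I : choiceType) (A : set I)
  (zeta : I -> {mfun T >-> Z}) (t0 : I).
Hypothesis zeta_indep : mutually_independent P A (fun t => zeta t : T -> Z).
Hypothesis At0 : A t0.

Definition other_cylinders : set (set T) :=
  [set E | exists (J : {fset I}) (B : I -> set Z),
    [/\ [set` J] `<=` A `\ t0, (forall i, measurable (B i)) &
        E = \bigcap_(i in [set` J]) (zeta i @^-1` B i)]].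

(* For a sample t0 this sigma-algebra makes measurable both the current iterates
   and the simultaneous gradients of the other workers. *)
Definition others := g_sigma_algebraType other_cylinders.

Lemma cylinder_measurable E : other_cylinders E -> measurable E.
Proof.
move=> [J [B [_ mB ->]]]; apply: fin_bigcap_measurable; first exact: finite_fset.
by move=> i _; exact: measurable_funPTI.
Qed.

Lemma others_measurable (E : set others) : measurable E -> d.-measurable (E : set T).
Proof.
apply: smallest_sub; first exact: sigma_algebra_measurable.
exact: cylinder_measurable.
Qed.

Lemma other_sample_measurable t : A t -> t != t0 ->
  measurable_fun setT (zeta t : others -> Z).
Proof.
move=> At tt0 _ B mB; rewrite setTI; apply: sub_sigma_algebra.
exists [fset t]%fset, (fun=> B); split => //.
  by move=> s /=; rewrite inE => /eqP ->; split=> // /eqP; rewrite (negPf tt0).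
by apply/seteqP; split => w /= h; [move=> s /=; rewrite inE => /eqP -> | apply: h; rewrite /= inE].
Qed.

Lemma other_cylinders_setI : setI_closed other_cylinders.
Proof.
move=> _ _ [J1 [B1 [J1A m1 ->]]] [J2 [B2 [J2A m2 ->]]].
exists (J1 `|` J2)%fset.
exists (fun i => (if i \in J1 then B1 i else setT) `&` (if i \in J2 then B2 i else setT)).
split.
- by move=> i /=; rewrite inE => /orP[/J1A|/J2A].
- by move=> i; apply: measurableI; case: ifP.
- apply/seteqP; split => [w [h1 h2] i /= _|w h].
    by split; case: ifP => // iJ; [exact: h1|exact: h2].
  split => i /= iJ; have := h i; rewrite /= inE iJ ?orbT => /(_ isT)[].
    by [].
  by move=> _.
Qed.

(** Dynkin's argument: on the generating cylinders, which are closed under intersection, the claim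
    is the product rule of the family, and the events satisfying it form a Dynkin system. *)
Lemma others_independent (E : set others) (C : set Z) :
  measurable E -> measurable C ->
  P (E `&` zeta t0 @^-1` C) = P E * P (zeta t0 @^-1` C).
Proof.
move=> mE mC.
have mz : measurable (zeta t0 @^-1` C) by exact: measurable_funPTI.
have := @dynkin_induction _ others other_cylinders
  (fun E => P (E `&` zeta t0 @^-1` C) = P E * P (zeta t0 @^-1` C)) erefl other_cylinders_setI.
apply => //.
- by rewrite setTI probability_setT mul1e.
- move=> _ [J [B [JA mB ->]]].
  have t0J : t0 \notin J by apply/negP => /JA [_]; apply.
  (* With [C] placed at [t0], one product rule over J and t0 covers the left side, and its factor at
     [t0] splits off. *)
  pose B' i := if i == t0 then C else B i.
  have mB' i : measurable (B' i) by rewrite /B'; case: ifP.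
  have B'E i : i \in J -> B' i = B i.
    by rewrite /B'; case: eqP => // -> ; rewrite (negPf t0J).
  have := zeta_indep (J := (t0 |` J)%fset) (B := B').
  move=> /(_ _ mB') h; have {}h := h _.
  have -> : \bigcap_(i in [set` J]) (zeta i @^-1` B i) `&` zeta t0 @^-1` C
     = \bigcap_(i in [set` (t0 |` J)%fset]) (zeta i @^-1` B' i).
    apply/seteqP; split => [w [h1 h2] i /=|w h1].
      rewrite !inE => /orP[/eqP->|iJ]; first by rewrite /B' eqxx.
      by rewrite B'E //; exact: h1.
    split => [i /= iJ|].
      by have := h1 i; rewrite /= !inE iJ orbT B'E // => /(_ isT).
    by have := h1 t0; rewrite /= !inE eqxx /B' eqxx => /(_ isT).
  rewrite h; last first.
    by move=> i /=; rewrite !inE => /orP[/eqP->|/JA[]].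
  rewrite big_fsetU1 //= /B' eqxx muleC; congr (_ * _).
  rewrite zeta_indep //; last by move=> i /JA[].
  apply: eq_big_seq => i iJ; have := B'E _ iJ; rewrite /B' => -> //.
- move=> S mS; move/others_measurable: mS => mS hS.
  have SE : P (S `&` zeta t0 @^-1` C) + P (~` S `&` zeta t0 @^-1` C) = P (zeta t0 @^-1` C).
    rewrite -measureU.
    - by rewrite -setIUl setUv setTI.
    - exact: measurableI.
    - by apply: measurableI => //; exact: measurableC.
    - by rewrite setIACA setICr set0I.
  have f1 : P (S `&` zeta t0 @^-1` C) \is a fin_num by exact: fin_num_measure (measurableI _ _ mS mz).
  have f2 : P (zeta t0 @^-1` C) \is a fin_num by exact: fin_num_measure.
  have -> : P (~` S `&` zeta t0 @^-1` C) = P (zeta t0 @^-1` C) - P (S `&` zeta t0 @^-1` C).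
    by rewrite -SE addeAC subee // add0e.
  by rewrite hS probability_setC // muleBl ?mul1e.
- move=> F mF tF hF.
  have mF' n : d.-measurable (F n : set T) by exact: others_measurable.
  rewrite setI_bigcupl !measure_bigcup //; last 2 first.
  - by move=> n _; exact: measurableI.
  - by move=> i j _ _ [w [[Fi _] [Fj _]]]; apply: tF => //; exists w.
  rewrite muleC -[in RHS](fineK (fin_num_measure P _ mz)) -nneseriesZl //.
  by apply: eq_eseriesr => n _ /=; rewrite hF muleC fineK // fin_num_measure.
Qed.
End IndependentFamily.

Section FreshGradient.
Context (R : realType) (p : nat) (d d1 dZ : measure_display) (T : measurableType d)
  (T1 : measurableType d1) (Z : measurableType dZ) (P : probability T R)
  (D : probability Z R) (U : {mfun T >-> T1}) (V : T -> Z).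
Hypothesis V_meas : measurable_fun setT V.
Hypothesis UV_law : forall A B, measurable A -> measurable B ->
  P (U @^-1` A `&` V @^-1` B) = (P (U @^-1` A) * D B)%E.
Variables (F : 'rV[R]_p -> Z -> R) (gbar : 'rV[R]_p -> 'rV[R]_p) (sigma : R).
Hypothesis F_meas : forall x, measurable_fun setT (F x).
Hypothesis F_diff : forall z x, differentiable (F^~ z : _ -> R^o) x.
Hypothesis gbar_cont : continuous gbar.
Hypothesis grad_int : forall x j,
  D.-integrable setT (fun z => (grad (F^~ z) x 0 j)%:E).
Hypothesis grad_unbiased : forall x j,
  (\int[D]_z (grad (F^~ z) x 0 j)%:E = (gbar x 0 j)%:E)%E.
Hypothesis grad_variance : forall x,
  (\int[D]_z (sqn (grad (F^~ z) x - gbar x))%:E <= (sigma ^+ 2)%:E)%E.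
Variable X : T1 -> 'rV[R]_p.
Hypothesis X_meas : forall j, measurable_fun setT (fun w => X w 0 j).

Let xi (w : T1) (z : Z) : 'rV[R]_p := grad (F^~ z) (X w) - gbar (X w).

Lemma measurable_continuous_comp d' (T' : measurableType d') (Y : T' -> 'rV[R]_p)
    (u : 'rV[R]_p -> R) :
  continuous (u : _ -> R^o) -> (forall j, measurable_fun setT (fun w => Y w 0 j)) ->
  measurable_fun setT (fun w => u (Y w)).
Proof.
(* The Carathéodory lemma for a function that ignores its sample. *)
move=> cu mY; apply: (@measurable_caratheodory R p _ _ T' T' (fun x _ => u x) Y id) => //.
Qed.

Lemma coord_comp_continuous (u : 'rV[R]_p -> 'rV[R]_p) j :
  continuous u -> continuous (fun x => u x 0 j : R^o).
Proof.
move=> cu x; apply: (@continuous_comp _ _ _ u (fun y : 'rV[R]_p => y 0 j : R^o)).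
  exact: cu.
exact: coord_continuous.
Qed.

Let xi_meas j : measurable_fun setT (fun wz : T1 * Z => xi wz.1 wz.2 0 j).
Proof.
have X1 k : measurable_fun setT (fun wz : T1 * Z => X wz.1 0 k).
  exact: (measurableT_comp (X_meas k) measurable_fst).
under eq_fun do rewrite !mxE.
apply: measurable_funB.
  have := measurable_grad_comp j F_meas F_diff X1 (@measurable_snd _ _ T1 Z).
  by under eq_fun do rewrite mxE.
exact: (measurable_continuous_comp (coord_comp_continuous gbar_cont) X1).
Qed.

Lemma measurable_sqn_comp k l d' (T' : measurableType d') (Y : T' -> 'M[R]_(k, l)) :
  (forall i j, measurable_fun setT (fun w => Y w i j)) ->
  measurable_fun setT (fun w => sqn (Y w)).
Proof.
move=> mY; rewrite /sqn; apply: measurable_sum => i; apply: measurable_sum => j.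
exact: measurable_funX.
Qed.

Lemma fresh_variance :
  (\int[P]_w (sqn (xi (U w) (V w)))%:E <= (sigma ^+ 2)%:E)%E.
Proof.
pose phi (wz : T1 * Z) := (sqn (xi wz.1 wz.2))%:E.
rewrite (ge0_integral_pair V_meas UV_law (phi := phi)) /phi /=.
- apply: (@le_trans _ _ (\int[distribution P U]_x (sigma ^+ 2)%:E)%E).
    apply: ge0_le_integral => //.
    + by move=> x _; apply: integral_ge0 => z _; rewrite lee_fin sqn_ge0.
    + apply: (@measurable_fun_fubini_tonelli_F _ _ T1 Z R D phi).
      - apply/measurable_EFinP/measurable_sqn_comp => i j; rewrite ord1; exact: xi_meas.
      - by move=> z; rewrite lee_fin sqn_ge0.
    + by move=> x _; exact: grad_variance.
  have D1 : distribution P U [set: T1] = 1%E by exact: probability_setT.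
  by rewrite integral_cst //= D1 mule1.
- apply/measurable_EFinP/measurable_sqn_comp => i j; rewrite ord1; exact: xi_meas.
- by move=> z; rewrite lee_fin sqn_ge0.
Qed.

(** Under the inner integral [h] and the point are frozen, and unbiasedness makes it zero. Both the
    linear noise term and the products of errors of different workers vanish for this reason. *)
Lemma fresh_mean (h : T1 -> R) j : measurable_fun setT h ->
  P.-integrable setT (fun w => (h (U w) * xi (U w) (V w) 0 j)%:E) ->
  (\int[P]_w (h (U w) * xi (U w) (V w) 0 j)%:E = 0)%E.
Proof.
move=> mh ih.
pose phi (wz : T1 * Z) := (h wz.1 * xi wz.1 wz.2 0 j)%:E.
rewrite (integral_pair V_meas UV_law (phi := phi)) // /phi /=; last first.
  apply/measurable_EFinP/measurable_funM; last exact: xi_meas.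
  exact: (measurableT_comp mh measurable_fst).
apply: integral0_eq => w _.
pose a z := grad (F^~ z) (X w) 0 j; pose b := gbar (X w) 0 j.
have ib : D.-integrable setT (fun=> b%:E) by exact: finite_measure_integrable_cst.
have ia : D.-integrable setT (fun z => (a z)%:E) by exact: grad_int.
have abE z : (h w * xi w z 0 j)%:E = ((h w)%:E * ((a z)%:E - b%:E))%E.
  rewrite EFinM -EFinB; congr (_ * _%:E)%E.
  have subE (A B : 'rV[R]_p) : (A - B) 0 j = A 0 j - B 0 j by rewrite !mxE.
  exact: subE.
under eq_integral do rewrite abE.
rewrite integralZl //; last exact: integrableB.
rewrite integralB // grad_unbiased integral_cst //= probability_setT mule1 subee //.
by rewrite mule0.
Qed.
End FreshGradient.

(** * Square-integrable random variables and matrices *)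

Section SquareIntegrable.
Context (R : realType) (d : measure_display) (T : measurableType d)
  (P : probability T R).
Implicit Types u v : T -> R.

Definition rintegrable u := P.-integrable setT (fun w => (u w)%:E).

Lemma rintegrable_le u v : measurable_fun setT u -> rintegrable v ->
  (forall w, `|u w| <= v w) -> rintegrable u.
Proof.
move=> mu iv h; apply: le_integrable iv => //; first exact/measurable_EFinP.
by move=> w _; rewrite /= lee_fin (le_trans (h w)) // ler_norm.
Qed.

Lemma rintegrable_cst c : rintegrable (fun=> c).
Proof. exact: finite_measure_integrable_cst. Qed.

Lemma rintegrableD u v : rintegrable u -> rintegrable v ->
  rintegrable (fun w => u w + v w).
Proof. by move=> iu iv; have := integrableD measurableT iu iv. Qed.

Lemma rintegrableB u v : rintegrable u -> rintegrable v ->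
  rintegrable (fun w => u w - v w).
Proof. by move=> iu iv; have := integrableB measurableT iu iv. Qed.

Lemma rintegrableZ c u : rintegrable u -> rintegrable (fun w => c * u w).
Proof. by move=> iu; have := integrableZl measurableT c iu. Qed.

Lemma rintegrable_sum n (u : 'I_n -> T -> R) : (forall i, rintegrable (u i)) ->
  rintegrable (fun w => \sum_i u i w).
Proof.
elim: n u => [|n IH] u iu.
  by under [X in rintegrable X]funext do rewrite big_ord0; exact: rintegrable_cst.
have -> : (fun w => \sum_i u i w) = (fun w => u ord0 w + \sum_(i < n) u (lift ord0 i) w).
  by apply/funext => w; rewrite big_ord_recl.
by apply: rintegrableD => //; exact: IH.
Qed.

Definition Ex u : R := \int[P]_w u w.

Lemma EFin_Ex u : rintegrable u -> (\int[P]_w (u w)%:E = (Ex u)%:E)%E.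
Proof. by move=> iu; rewrite /Ex /Rintegral fineK // integrable_fin_num. Qed.

Lemma Ex_cst c : Ex (fun=> c) = c.
Proof. by rewrite /Ex Rintegral_cst //= probability_setT mulr1. Qed.

Lemma ExD u v : rintegrable u -> rintegrable v -> Ex (fun w => u w + v w) = Ex u + Ex v.
Proof. by move=> iu iv; rewrite /Ex RintegralD. Qed.

Lemma ExZ c u : rintegrable u -> Ex (fun w => c * u w) = c * Ex u.
Proof. by move=> iu; rewrite /Ex RintegralZl. Qed.

Lemma Ex_le u v : rintegrable u -> rintegrable v -> (forall w, u w <= v w) -> Ex u <= Ex v.
Proof. by move=> iu iv h; apply: le_Rintegral. Qed.

Lemma Ex_sum n (u : 'I_n -> T -> R) : (forall i, rintegrable (u i)) ->
  Ex (fun w => \sum_i u i w) = \sum_i Ex (u i).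
Proof.
elim: n u => [|n IH] u iu.
  by rewrite big_ord0 -[RHS]Ex_cst; congr (Ex _); apply/funext => w; rewrite big_ord0.
rewrite big_ord_recl -IH // -ExD //; last by exact: rintegrable_sum.
by congr (Ex _); apply/funext => w; rewrite big_ord_recl.
Qed.

(** Measurability is a separate clause because that of the square does not imply it. *)
Definition sqint u := measurable_fun setT u /\ rintegrable (fun w => u w ^+ 2).

Lemma sqint_le u v : measurable_fun setT u -> rintegrable v ->
  (forall w, u w ^+ 2 <= v w) -> sqint u.
Proof.
move=> mu iv h; split=> //; apply: (rintegrable_le _ iv); first exact: measurable_funX.
by move=> w; rewrite ger0_norm ?sqr_ge0.
Qed.

Lemma sqint_cst c : sqint (fun=> c).
Proof. by split; [exact: measurable_cst | exact: rintegrable_cst]. Qed.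

Lemma sqintD u v : sqint u -> sqint v -> sqint (fun w => u w + v w).
Proof.
move=> [mu iu] [mv iv]; apply: (@sqint_le _ (fun w => 2 * u w ^+ 2 + 2 * v w ^+ 2)).
- exact: measurable_funD.
- by apply: rintegrableD; exact: rintegrableZ.
- by move=> w; have := sqr_ge0 (u w - v w); nra.
Qed.

Lemma sqintZ c u : sqint u -> sqint (fun w => c * u w).
Proof.
move=> [mu iu]; apply: (@sqint_le _ (fun w => c ^+ 2 * u w ^+ 2)).
- by apply: measurable_funM => //; exact: measurable_cst.
- exact: rintegrableZ.
- by move=> w; rewrite exprMn.
Qed.

Lemma sqintB u v : sqint u -> sqint v -> sqint (fun w => u w - v w).
Proof.
move=> su /(sqintZ (-1)) sv; have := sqintD su sv.
by congr sqint; apply/funext => w; rewrite mulN1r.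
Qed.

Lemma sqint_sum n (u : 'I_n -> T -> R) : (forall i, sqint (u i)) ->
  sqint (fun w => \sum_i u i w).
Proof.
elim: n u => [|n IH] u iu.
  have -> : (fun w => \sum_i u i w) = (fun=> 0) by apply/funext => w; rewrite big_ord0.
  exact: sqint_cst.
have -> : (fun w => \sum_i u i w) = (fun w => u ord0 w + \sum_(i < n) u (lift ord0 i) w).
  by apply/funext => w; rewrite big_ord_recl.
by apply: sqintD => //; exact: IH.
Qed.

Lemma sqintM u v : sqint u -> sqint v -> rintegrable (fun w => u w * v w).
Proof.
move=> [mu iu] [mv iv]; apply: (@rintegrable_le _ (fun w => u w ^+ 2 + v w ^+ 2)).
- exact: measurable_funM.
- exact: rintegrableD.
- move=> w; rewrite ler_norml; apply/andP; split.
    by have := sqr_ge0 (u w + v w); have := sqr_ge0 (u w); have := sqr_ge0 (v w); nra.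
  by have := sqr_ge0 (u w - v w); have := sqr_ge0 (u w); have := sqr_ge0 (v w); nra.
Qed.

Definition msqint k l (Y : T -> 'M[R]_(k, l)) := forall i j, sqint (fun w => Y w i j).

Lemma msqint_cst k l (c : 'M[R]_(k, l)) : msqint (fun=> c).
Proof. by move=> i j; exact: sqint_cst. Qed.

Lemma msqintD k l (Y Y' : T -> 'M[R]_(k, l)) : msqint Y -> msqint Y' ->
  msqint (fun w => Y w + Y' w).
Proof. by move=> h h' i j; under eq_fun do rewrite mxE; exact: sqintD. Qed.

Lemma msqintZ k l c (Y : T -> 'M[R]_(k, l)) : msqint Y -> msqint (fun w => c *: Y w).
Proof. by move=> h i j; under eq_fun do rewrite mxE; exact: sqintZ. Qed.

Lemma msqintB k l (Y Y' : T -> 'M[R]_(k, l)) : msqint Y -> msqint Y' ->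
  msqint (fun w => Y w - Y' w).
Proof. by move=> h h' i j; under eq_fun do rewrite 2!mxE; exact: sqintB. Qed.

Lemma msqint_mulmx k n l (W : 'M[R]_(k, n)) (Y : T -> 'M[R]_(n, l)) :
  msqint Y -> msqint (fun w => W *m Y w).
Proof.
move=> h i j; under eq_fun do rewrite mxE.
by apply: sqint_sum => a; exact: sqintZ.
Qed.

Lemma msqint_mean k l (Y : T -> 'M[R]_(k, l)) : msqint Y -> msqint (fun w => mean (Y w)).
Proof.
move=> h i j.
have -> : (fun w => mean (Y w) i j) = (fun w => k%:R^-1 * \sum_a Y w a j).
  apply/funext => w; rewrite /mean mxE summxE; congr (_ * _).
  by apply: eq_bigr => a _; rewrite mxE.
by apply: sqintZ; apply: sqint_sum.
Qed.

Lemma msqint_dev k l (Y : T -> 'M[R]_(k, l)) : msqint Y -> msqint (fun w => dev (Y w)).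
Proof.
move=> h; apply: msqintB => // i j.
have -> : (fun w => (\matrix_(i < k) mean (Y w)) i j) = (fun w => mean (Y w) 0 j).
  by apply/funext => w; rewrite mxE.
exact: msqint_mean.
Qed.

Lemma msqint_sqn k l (Y : T -> 'M[R]_(k, l)) : msqint Y -> rintegrable (fun w => sqn (Y w)).
Proof.
by move=> h; apply: rintegrable_sum => i; apply: rintegrable_sum => j; have [] := h i j.
Qed.

Lemma msqint_edot l (Y Y' : T -> 'rV[R]_l) : msqint Y -> msqint Y' ->
  rintegrable (fun w => edot (Y w) (Y' w)).
Proof. by move=> h h'; apply: rintegrable_sum => j; exact: sqintM. Qed.

Lemma msqint_sqn_le k l (Y : T -> 'M[R]_(k, l)) v :
  (forall i j, measurable_fun setT (fun w => Y w i j)) -> rintegrable v ->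
  (forall w, sqn (Y w) <= v w) -> msqint Y.
Proof.
move=> mY iv h i j; apply: (sqint_le _ iv) => // w; apply: le_trans (h w).
rewrite /sqn (bigD1 i) //= (bigD1 j) //= -addrA lerDl.
by apply: addr_ge0; apply: sumr_ge0 => a _; [|apply: sumr_ge0 => b _]; exact: sqr_ge0.
Qed.

End SquareIntegrable.

(** * Expectations along the iterates *)

(* Local round k of communication round s is step n = s K + k, and row i of a
   matrix belongs to worker i. The step from (s, K) to (s + 1, 0), which changes
   nothing, is not counted. *)
Record flat_iterates (R : realType) (m p K N : nat) (T Z : Type)
    (F : 'I_m -> 'rV[R]_p -> Z -> R) (W : 'M[R]_m) (x0 : 'rV[R]_p) (eta : R)
    (zeta : 'I_m -> nat -> T -> Z) (x y g : nat -> T -> 'M[R]_(m, p)) : Prop := {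
  flat_x0 : forall w, x 0 w = \matrix_i x0;
  flat_y0 : forall w, y 0 w = g 0 w;
  flat_g : forall n w, (n <= N)%N ->
    g n w = \matrix_i sgrad F i (row i (x n w)) (zeta i n w);
  flat_x : forall n w, (n < N)%N ->
    x n.+1 w = (if (K %| n)%N then W *m x n w else x n w) - eta *: y n w;
  flat_y : forall n w, (n < N)%N ->
    y n.+1 w = (if (K %| n)%N then W *m y n w else y n w) + g n.+1 w - g n w }.

Section FlatMeasurability.
Context (R : realType) (m p K N : nat) (d dZ : measure_display)
  (T : measurableType d) (Z : measurableType dZ).
Variables (F : 'I_m -> 'rV[R]_p -> Z -> R) (W : 'M[R]_m) (x0 : 'rV[R]_p) (eta : R)
  (zeta : 'I_m -> nat -> T -> Z) (x y g : nat -> T -> 'M[R]_(m, p)).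
Hypothesis F_meas : forall i x, measurable_fun setT (F i x).
Hypothesis F_diff : forall i z x, differentiable ((F i)^~ z : _ -> R^o) x.
Hypothesis flat : flat_iterates K N F W x0 eta zeta x y g.

Definition mmeas k l (Y : T -> 'M[R]_(k, l)) :=
  forall i j, measurable_fun setT (fun w => Y w i j).

Lemma mmeasD k l (Y Y' : T -> 'M[R]_(k, l)) : mmeas Y -> mmeas Y' ->
  mmeas (fun w => Y w + Y' w).
Proof. by move=> h h' i j; under eq_fun do rewrite mxE; exact: measurable_funD. Qed.

Lemma mmeasB k l (Y Y' : T -> 'M[R]_(k, l)) : mmeas Y -> mmeas Y' ->
  mmeas (fun w => Y w - Y' w).
Proof. by move=> h h' i j; under eq_fun do rewrite 2!mxE; exact: measurable_funB. Qed.

Lemma mmeasZ k l c (Y : T -> 'M[R]_(k, l)) : mmeas Y -> mmeas (fun w => c *: Y w).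
Proof.
move=> h i j; under eq_fun do rewrite mxE.
by apply: measurable_funM => //; exact: measurable_cst.
Qed.

Lemma mmeas_mulmx k n l (A : 'M[R]_(k, n)) (Y : T -> 'M[R]_(n, l)) :
  mmeas Y -> mmeas (fun w => A *m Y w).
Proof.
move=> h i j; under eq_fun do rewrite mxE.
apply: measurable_sum => a.
by apply: measurable_funM => //; exact: measurable_cst.
Qed.

Lemma mmeas_mix n (Y : T -> 'M[R]_(m, p)) : mmeas Y ->
  mmeas (fun w => if (K %| n)%N then W *m Y w else Y w).
Proof. by case: (K %| n)%N => //; exact: mmeas_mulmx. Qed.

(** Stated for one row: without the sample of one worker at step n, the gradients of the other
    workers at that step must remain measurable. *)
Lemma flat_g_row_meas i n j : (n <= N)%N -> mmeas (x n) -> measurable_fun setT (zeta i n) ->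
  measurable_fun setT (fun w => g n w i j).
Proof.
move=> nN mx mz.
have -> : (fun w => g n w i j) = (fun w => grad ((F i)^~ (zeta i n w)) (row i (x n w)) 0 j).
  by apply/funext => w; rewrite (flat_g flat w nN) mxE.
apply: measurable_grad_comp => // k.
by under eq_fun do rewrite mxE; exact: mx.
Qed.

(** [x M] uses only samples of steps before M, while [g] and [y] at a step also use its own sample;
    hence the two ranges of n. The sigma-algebra is left open, to be the full one or that of the
    samples other than a given one. *)
Lemma flat_meas M n : (M <= N.+1)%N ->
  (forall i l, (l < M)%N -> measurable_fun setT (zeta i l)) ->
  ((n <= M)%N -> (n <= N)%N -> mmeas (x n)) /\ ((n < M)%N -> mmeas (g n) /\ mmeas (y n)).
Proof.
move=> MN mz.
have mg k : (k < M)%N -> mmeas (x k) -> mmeas (g k).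
  move=> kM mxk i j; apply: flat_g_row_meas => //; last exact: mz.
  by rewrite -ltnS (leq_trans kM).
elim: n => [|n [IHx IHg]].
  have mx0 : mmeas (x 0).
    move=> i j; have -> : (fun w => x 0 w i j) = (fun=> x0 0 j).
      by apply/funext => w; rewrite (flat_x0 flat) mxE.
    exact: measurable_cst.
  split=> // M0; have mg0 := mg 0 M0 mx0; split => // i j.
  by under eq_fun do rewrite (flat_y0 flat); exact: mg0.
have mx1 : (n.+1 <= M)%N -> (n.+1 <= N)%N -> mmeas (x n.+1).
  move=> nM nN; have [_ my] := IHg nM.
  have -> : x n.+1 = (fun w => (if (K %| n)%N then W *m x n w else x n w) - eta *: y n w).
    by apply/funext => w; exact: (flat_x flat).
  by apply: mmeasB; [apply: mmeas_mix; apply: IHx; exact: ltnW | exact: mmeasZ].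
split=> // nM.
have nN : (n < N)%N by rewrite -ltnS (leq_trans nM).
have mg1 := mg _ nM (mx1 (ltnW nM) nN).
have [mgn myn] := IHg (ltnW nM); split=> //.
have -> : y n.+1 = (fun w => (if (K %| n)%N then W *m y n w else y n w) + g n.+1 w - g n w).
  by apply/funext => w; exact: (flat_y flat).
by apply: mmeasB => //; apply: mmeasD => //; exact: mmeas_mix.
Qed.
End FlatMeasurability.

Lemma two_plus_one_le (R : realFieldType) (a b v : R) :
  a <= v -> b <= v -> 2 * a + b <= 3 * v.
Proof. lra. Qed.

Lemma round_noise_arith (R : realFieldType) (k v a b : R) :
  1 * v <= k * v -> a <= (k + 1) * v -> b <= k * (3 * v) -> 3 * a + b <= 9 * k * v.
Proof. lra. Qed.

Section FlatExpectation.
Context (R : realType) (m p K N : nat) (d dZ : measure_display)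
  (T : measurableType d) (Z : measurableType dZ) (P : probability T R)
  (D : 'I_m -> probability Z R) (F : 'I_m -> 'rV[R]_p -> Z -> R) (L sigma : R)
  (W : 'M[R]_m) (x0 : 'rV[R]_p) (eta : R)
  (zeta : 'I_m -> nat -> {mfun T >-> Z}) (x y g : nat -> T -> 'M[R]_(m, p)).
Hypothesis m0 : (0 < m)%N.
Hypothesis problem : stochastic_problem D F L sigma.
Hypothesis zeta_law : forall i n, (n <= N)%N ->
  forall B, measurable B -> P (zeta i n @^-1` B) = D i B.
Let zt (t : 'I_m * nat) : {mfun T >-> Z} := zeta t.1 t.2.
Let A : set ('I_m * nat) := [set t | (t.2 <= N)%N].
Hypothesis zeta_indep : mutually_independent P A (fun t => zt t : T -> Z).
Hypothesis flat : flat_iterates K N F W x0 eta (fun i n => zeta i n : T -> Z) x y g.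

Let fi := local_loss D F.
Let h n w := local_grads fi (x n w).
Let xi n w := g n w - h n w.

Lemma sample_meas i v : measurable_fun setT (F i v).
Proof. by have /measurable_int/measurable_EFinP := asm_sample_int problem i v. Qed.

Lemma sample_diff i z v : differentiable ((F i)^~ z : _ -> R^o) v.
Proof. exact: asm_sample_diff problem i z v. Qed.

Lemma local_loss_lip i x1 x2 :
  sqn (grad (fi i) x1 - grad (fi i) x2) <= L ^+ 2 * sqn (x1 - x2).
Proof.
rewrite -!enorm_sqr -exprMn; have := asm_grad_lip problem i x1 x2.
have e0 (v : 'rV[R]_p) : 0 <= enorm v by exact: sqrtr_ge0.
move=> hl; rewrite lerXn2r ?nnegrE //.
exact: (le_trans (e0 _) hl).
Qed.

Let O t := others A zt t.

Let to_others_meas t : measurable_fun setT (id : T -> O t).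
Proof. by move=> _ B mB; rewrite setTI; exact: (others_measurable mB). Qed.

(** The identity into the coarser sigma-algebra: the random variable that carries all other
    samples. *)
Let to_others t : {mfun T >-> O t} := HB.pack (id : T -> O t) (isMeasurableFun.Build _ _ _ _ _ (@to_others_meas t)).

Let fresh_law i n : (n <= N)%N -> forall E C, measurable E -> measurable C ->
  P (to_others (i, n) @^-1` E `&` zeta i n @^-1` C) = (P (to_others (i, n) @^-1` E) * D i C)%E.
Proof.
move=> nN E C mE mC; rewrite -(zeta_law i nN mC).
exact: (others_independent (t0 := (i, n)) zeta_indep).
Qed.

Lemma other_iterates_meas i n : (n <= N)%N -> mmeas (fun w : O (i, n) => x n w).
Proof.
move=> nN.
have [] := @flat_meas R m p K N _ dZ (O (i, n)) Z F W x0 eta _ x y g sample_meas sample_diff flat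
  n n (leqW nN) _; last by move=> + _; apply.
move=> k l ln; apply: (@other_sample_measurable _ dZ T Z _ A zt (i, n) (k, l)).
  by rewrite /A /=; exact: ltnW (leq_trans ln nN).
by apply/eqP => -[_ ln']; rewrite ln' ltnn in ln.
Qed.

Lemma other_grad_meas i k n j : (n <= N)%N -> k != i ->
  measurable_fun setT (fun w : O (i, n) => g n w k j).
Proof.
move=> nN ki; apply: (@flat_g_row_meas R m p K N _ dZ (O (i, n)) Z F W x0 eta _ x y g
  sample_meas sample_diff flat k n j nN (@other_iterates_meas i n nN)).
apply: (@other_sample_measurable _ dZ T Z _ A zt (i, n) (k, n)) => //.
by apply: contra ki => /eqP[->].
Qed.

Lemma rows_meas d' (T' : measurableType d') (Y : T' -> 'M[R]_(m, p)) i : mmeas Y ->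
  forall j, measurable_fun setT (fun w => row i (Y w) 0 j).
Proof. by move=> mY j; under eq_fun do rewrite mxE; exact: mY. Qed.

Lemma iterates_meas n : (n <= N)%N -> [/\ mmeas (x n), mmeas (g n) & mmeas (y n)].
Proof.
move=> nN.
have [] := @flat_meas R m p K N _ dZ T Z F W x0 eta _ x y g sample_meas sample_diff flat
  N.+1 n (leqnn _) _; first by move=> i l _; exact: measurable_funPT.
by move=> mx mgy; have [mg my] := mgy nN; split=> //; apply: mx => //; exact: leqW.
Qed.

Lemma xi_row n w i : (n <= N)%N ->
  row i (xi n w) = grad ((F i)^~ (zeta i n w)) (row i (x n w)) - grad (fi i) (row i (x n w)).
Proof. by move=> nN; rewrite /xi (flat_g flat w nN) linearB /= !rowK. Qed.

Lemma local_grads_meas d' (T' : measurableType d') (Y : T' -> 'M[R]_(m, p)) : mmeas Y ->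
  mmeas (fun w => local_grads fi (Y w)).
Proof.
move=> mY i j.
have -> : (fun w => local_grads fi (Y w) i j) = (fun w => grad (fi i) (row i (Y w)) 0 j).
  by apply/funext => w; rewrite [LHS]mxE.
apply: (@measurable_continuous_comp R p _ _ _ (fun v => grad (fi i) v 0 j)).
  apply: (@coord_comp_continuous R p (grad (fi i))). exact: (asm_grad_cont problem).
exact: rows_meas.
Qed.

Let sgrad_unbiased i v j :
  (\int[D i]_z (grad ((F i)^~ z) v 0 j)%:E = (grad (fi i) v 0 j)%:E)%E.
Proof. by have := asm_unbiased problem i v j; rewrite unlock. Qed.

Let sgrad_variance i v :
  (\int[D i]_z (sqn (grad ((F i)^~ z) v - grad (fi i) v))%:E <= (sigma ^+ 2)%:E)%E.
Proof.
have := asm_variance problem i v; rewrite unlock.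
by under eq_integral do rewrite enorm_sqr.
Qed.

Lemma xi_variance i n : (n <= N)%N ->
  rintegrable P (fun w => sqn (row i (xi n w))) /\ Ex P (fun w => sqn (row i (xi n w))) <= sigma ^+ 2.
Proof.
move=> nN.
have hv : (\int[P]_w (sqn (row i (xi n w)))%:E <= (sigma ^+ 2)%:E)%E.
  have gc : continuous (grad (fi i)) by exact: (asm_grad_cont problem).
  have := @fresh_variance R p _ _ dZ T (O (i, n)) Z P (D i) (to_others (i, n)) (zeta i n)
    (measurable_funPT _) (@fresh_law i n nN) (F i) (grad (fi i)) sigma (sample_meas i)
    (sample_diff i) gc (sgrad_variance i) (fun w => row i (x n w))
    (@rows_meas _ (O (i, n)) (fun w => x n w) i (@other_iterates_meas i n nN)).
  by under [X in _ -> (X <= _)%E]eq_integral do rewrite xi_row //.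
have [mx mg _] := iterates_meas nN.
have mxi : mmeas (xi n) by apply: mmeasB => //; exact: local_grads_meas.
have ir : rintegrable P (fun w => sqn (row i (xi n w))).
  apply/integrableP; split.
    apply/measurable_EFinP/measurable_sqn_comp => a j; rewrite ord1.
    exact: rows_meas.
  apply: (@le_lt_trans _ _ (sigma ^+ 2)%:E); last exact: ltry.
  apply: le_trans hv; rewrite le_eqVlt; apply/orP; left; apply/eqP.
  by apply: eq_integral => w _; rewrite gee0_abs // lee_fin sqn_ge0.
by split => //; rewrite -lee_fin -EFin_Ex.
Qed.

Lemma xi_sqint n : (n <= N)%N -> msqint P (xi n).
Proof.
move=> nN; have [mx mg _] := iterates_meas nN.
apply: (msqint_sqn_le _ (v := fun w => \sum_i sqn (row i (xi n w)))).
- by apply: mmeasB => //; exact: local_grads_meas.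
- by apply: rintegrable_sum => i; have [] := xi_variance i nN.
- by move=> w; rewrite sqn_rows.
Qed.

Lemma xi_mean i n (u : T -> R) j : (n <= N)%N ->
  measurable_fun setT (fun w : O (i, n) => u w) -> sqint P u ->
  Ex P (fun w => u w * xi n w i j) = 0.
Proof.
move=> nN mu su.
have ii : rintegrable P (fun w => u w * xi n w i j).
  by apply: sqintM => //; exact: xi_sqint.
apply: EFin_inj; rewrite -EFin_Ex //.
have xE w : xi n w i j = (grad ((F i)^~ (zeta i n w)) (row i (x n w)) - grad (fi i) (row i (x n w))) 0 j.
  by rewrite -xi_row // [RHS]mxE.
have gc : continuous (grad (fi i)) by exact: (asm_grad_cont problem).
have := @fresh_mean R p _ _ dZ T (O (i, n)) Z P (D i) (to_others (i, n)) (zeta i n)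
    (measurable_funPT _) (@fresh_law i n nN) (F i) (grad (fi i)) (sample_meas i)
    (sample_diff i) gc (asm_sgrad_int problem i) (sgrad_unbiased i) (fun w => row i (x n w))
    (@rows_meas _ (O (i, n)) (fun w => x n w) i (@other_iterates_meas i n nN)) u j mu.
have -> : (fun w => (u w * xi n w i j)%:E) = (fun w => (u w *
   (grad ((F i)^~ (zeta i n w)) (row i (x n w)) - grad (fi i) (row i (x n w))) 0 j)%:E).
  by apply/funext => w; rewrite xE.
apply.
move: ii; congr rintegrable.
by apply/funext => w; rewrite xE.
Qed.

Lemma local_grads_sqint (Y : T -> 'M[R]_(m, p)) : msqint P Y ->
  msqint P (fun w => local_grads fi (Y w)).
Proof.
move=> sY; apply: (msqint_sqn_le _
  (v := fun w => 2 * sqn (local_grads fi 0) + 2 * L ^+ 2 * sqn (Y w))).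
- by apply: local_grads_meas => i j; have [] := sY i j.
- apply: rintegrableD; first exact: rintegrable_cst.
  by apply: rintegrableZ; exact: msqint_sqn.
- move=> w.
  have -> : local_grads fi (Y w) = local_grads fi 0 + (local_grads fi (Y w) - local_grads fi 0).
    by rewrite addrC subrK.
  apply: (le_trans (sqnD2 _ _)); rewrite lerD2l -mulrA ler_wpM2l //.
  by have := local_grads_lip local_loss_lip (Y w) 0; rewrite subr0.
Qed.

(** Lipschitz gradients grow linearly and the errors have finite variance, so each step preserves
    square integrability. This permits splitting the expectation of the final inequality term by
    term. *)
Lemma iterates_sqint n : (n <= N)%N -> [/\ msqint P (x n), msqint P (g n) & msqint P (y n)].
Proof.
have sg k : (k <= N)%N -> msqint P (x k) -> msqint P (g k).
  move=> kN sx; have -> : g k = (fun w => h k w + xi k w).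
    by apply/funext => w; rewrite /xi addrC subrK.
  by apply: msqintD; [exact: local_grads_sqint | exact: xi_sqint].
have mix k (Y : T -> 'M[R]_(m, p)) : msqint P Y ->
    msqint P (fun w => if (K %| k)%N then W *m Y w else Y w).
  by case: (K %| k)%N => //; exact: msqint_mulmx.
elim: n => [|n IH] nN.
  have sx0 : msqint P (x 0).
    have -> : x 0 = (fun=> \matrix_i x0) by apply/funext => w; exact: (flat_x0 flat).
    exact: msqint_cst.
  have sg0 := sg 0 nN sx0; split => //.
  by have -> : y 0 = g 0 by apply/funext => w; exact: (flat_y0 flat).
have [sx sgn sy] := IH (ltnW nN).
have sx1 : msqint P (x n.+1).
  have -> : x n.+1 = (fun w => (if (K %| n)%N then W *m x n w else x n w) - eta *: y n w).
    by apply/funext => w; exact: (flat_x flat).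
  by apply: msqintB; [exact: mix | exact: msqintZ].
have sg1 := sg _ nN sx1; split => //.
have -> : y n.+1 = (fun w => (if (K %| n)%N then W *m y n w else y n w) + g n.+1 w - g n w).
  by apply/funext => w; exact: (flat_y flat).
by apply: msqintB => //; apply: msqintD => //; exact: mix.
Qed.

Lemma mmeas_mean k l d' (T' : measurableType d') (Y : T' -> 'M[R]_(k, l)) : mmeas Y ->
  mmeas (fun w => mean (Y w)).
Proof.
move=> mY i j.
have -> : (fun w => mean (Y w) i j) = (fun w => k%:R^-1 * \sum_a Y w a j).
  apply/funext => w; rewrite /mean mxE summxE; congr (_ * _).
  by apply: eq_bigr => a _; rewrite mxE.
apply: measurable_funM; first exact: measurable_cst.
by apply: measurable_sum => a; exact: mY.
Qed.

Lemma other_xi_meas i k n j : (n <= N)%N -> k != i ->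
  measurable_fun setT (fun w : O (i, n) => xi n w k j).
Proof.
move=> nN ki.
have -> : (fun w : O (i, n) => xi n w k j) = (fun w : O (i, n) => g n w k j - h n w k j).
  by apply/funext => w; rewrite /xi [LHS]mxE [X in _ + X]mxE.
apply: measurable_funB; first exact: other_grad_meas.
exact: (@local_grads_meas _ (O (i, n)) (fun w => x n w) (@other_iterates_meas i n nN)).
Qed.

Lemma Ex_xi_total n : (n <= N)%N -> Ex P (fun w => sqn (xi n w)) <= m%:R * sigma ^+ 2.
Proof.
move=> nN.
have -> : (fun w => sqn (xi n w)) = (fun w => \sum_i sqn (row i (xi n w))).
  by apply/funext => w; exact: sqn_rows.
rewrite Ex_sum; last by move=> i; have [] := xi_variance i nN.
apply: (@le_trans _ _ (\sum_(i < m) sigma ^+ 2)).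
  by apply: ler_sum => i _; have [] := xi_variance i nN.
by rewrite sumr_const card_ord mulr_natl.
Qed.

(* Across workers the errors are uncorrelated, which gains the factor 1/m. *)
Lemma Ex_xi_mean n : (n <= N)%N -> Ex P (fun w => sqn (mean (xi n w))) <= sigma ^+ 2 / m%:R.
Proof.
move=> nN; have sxi := xi_sqint nN.
have mR : 0 < m%:R :> R by rewrite ltr0n.
have ip i k j : rintegrable P (fun w => xi n w i j * xi n w k j) by apply: sqintM.
have E : (fun w => sqn (mean (xi n w))) = (fun w => (m%:R ^+ 2)^-1 *
    \sum_j \sum_i \sum_k xi n w i j * xi n w k j).
  apply/funext => w; rewrite sqn_row mulr_sumr; apply: eq_bigr => j _.
  have -> : mean (xi n w) 0 j = m%:R^-1 * \sum_i xi n w i j.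
    by rewrite /mean mxE summxE; congr (_ * _); apply: eq_bigr => a _; rewrite mxE.
  by rewrite exprMn exprVn [(\sum_i _) ^+ 2]expr2; congr (_ * _); rewrite mulr_suml;
    apply: eq_bigr => i _; rewrite mulr_sumr.
have iS j i : rintegrable P (fun w => \sum_k xi n w i j * xi n w k j).
  by apply: rintegrable_sum.
have iSS j : rintegrable P (fun w => \sum_i \sum_k xi n w i j * xi n w k j).
  by apply: rintegrable_sum.
rewrite E ExZ; last exact: rintegrable_sum.
rewrite Ex_sum //.
under eq_bigr => j _.
  rewrite Ex_sum //; under eq_bigr => i _.
    rewrite Ex_sum // (bigD1 i) //= big1 ?addr0; last first.
      (* The error of worker i is the factor measurable without the sample of worker k. *)
      by move=> k ki; apply: (xi_mean _ nN (other_xi_meas j nN _) (sxi i j)); rewrite eq_sym.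
  over.
over.
rewrite exchange_big /=.
rewrite mulrC ler_pdivrMr ?exprn_gt0 // expr2 mulrA divfK ?gt_eqF // [leRHS]mulrC.
apply: le_trans (Ex_xi_total nN).
have -> : (fun w => sqn (xi n w)) = (fun w => \sum_i \sum_j xi n w i j * xi n w i j).
  by apply/funext => w; apply: eq_bigr => i _; apply: eq_bigr => j _; rewrite expr2.
rewrite Ex_sum; last by move=> i; exact: rintegrable_sum.
apply: ler_sum => i _; rewrite Ex_sum //.
Qed.

Lemma Ex_edot_xi n (u : T -> 'rV[R]_p) : (n <= N)%N -> msqint P u ->
  (forall i, mmeas (fun w : O (i, n) => u w)) ->
  Ex P (fun w => edot (u w) (mean (xi n w))) = 0.
Proof.
move=> nN su mu; have sxi := xi_sqint nN.
have ip i j : rintegrable P (fun w => u w 0 j * xi n w i j) by apply: sqintM.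
have -> : (fun w => edot (u w) (mean (xi n w))) = (fun w => m%:R^-1 *
    \sum_j \sum_i u w 0 j * xi n w i j).
  apply/funext => w; rewrite /edot mulr_sumr; apply: eq_bigr => j _.
  have -> : mean (xi n w) 0 j = m%:R^-1 * \sum_i xi n w i j.
    by rewrite /mean mxE summxE; congr (_ * _); apply: eq_bigr => a _; rewrite mxE.
  by rewrite mulrCA; congr (_ * _); rewrite mulr_sumr.
have iS j : rintegrable P (fun w => \sum_i u w 0 j * xi n w i j) by apply: rintegrable_sum.
rewrite ExZ; last exact: rintegrable_sum.
rewrite Ex_sum // big1 ?mulr0 // => j _; rewrite Ex_sum // big1 // => i _.
by apply: xi_mean => //; exact: mu.
Qed.

Let f := mean_fun fi.
Let fi_diff i v : differentiable (fi i : _ -> R^o) v := asm_diff problem i v.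
Hypothesis L0 : 0 < L.

Lemma grad_mean_funE v : grad f v = mean (local_grads fi (\matrix_i v)).
Proof.
rewrite /f (grad_mean_fun fi_diff); congr mean; apply/row_matrixP => i.
by rewrite !rowK.
Qed.

Lemma const_rows_meas d' (T' : measurableType d') (Y : T' -> 'rV[R]_p) : mmeas Y ->
  mmeas (fun w => \matrix_(i < m) Y w).
Proof. by move=> mY i j; under eq_fun do rewrite mxE; exact: mY. Qed.

Lemma grad_mean_sqint n : (n <= N)%N -> msqint P (fun w => grad f (mean (x n w))).
Proof.
move=> nN; have [sx _ _] := iterates_sqint nN.
have -> : (fun w => grad f (mean (x n w))) =
   (fun w => mean (local_grads fi (\matrix_i mean (x n w)))).
  by apply/funext => w; rewrite grad_mean_funE.
apply: msqint_mean; apply: local_grads_sqint => i j.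
have -> : (fun w => (\matrix_(i < m) mean (x n w)) i j) = (fun w => mean (x n w) 0 j).
  by apply/funext => w; rewrite mxE.
exact: msqint_mean.
Qed.

Lemma grad_mean_meas n i : (n <= N)%N -> mmeas (fun w : O (i, n) => grad f (mean (x n w))).
Proof.
move=> nN.
have -> : (fun w : O (i, n) => grad f (mean (x n w))) =
   (fun w : O (i, n) => mean (local_grads fi (\matrix_i mean (x n w)))).
  by apply/funext => w; rewrite grad_mean_funE.
apply: mmeas_mean; apply: local_grads_meas; apply: const_rows_meas; apply: mmeas_mean.
exact: other_iterates_meas.
Qed.

Lemma mean_fun_rintegrable n : (n <= N)%N -> rintegrable P (fun w => f (mean (x n w))).
Proof.
move=> nN; have [sx _ _] := iterates_sqint nN.
apply: (@rintegrable_le _ _ _ P _ (fun w => (`|f 0| + sqn (grad f 0)) + (1 + L) * sqn (mean (x n w)))).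
- have fc : continuous (f : _ -> R^o).
    by move=> v; apply: differentiable_continuous; exact: mean_fun_diff.
  apply: (measurable_continuous_comp fc) => j.
  by have [] := msqint_mean sx 0 j.
- apply: rintegrableD; first exact: rintegrable_cst.
  by apply: rintegrableZ; apply: msqint_sqn; exact: msqint_mean.
- move=> w; set v := mean _.
  have := descent 0 v L0 (mean_fun_diff fi_diff) (grad_mean_fun_lip m0 fi_diff local_loss_lip).
  rewrite add0r -/f => hd.
  have y1 := edot_young (grad f 0) v ltr01.
  have y2 := edot_young (grad f 0) (- v) ltr01.
  rewrite edotNr sqnN in y2; rewrite invr1 !mul1r in y1 y2.
  have s0 := sqn_ge0 (grad f 0); have s1 := sqn_ge0 v.
  have Ls := mulr_ge0 (ltW L0) s1.
  move: hd; rewrite ler_norml => /andP[h1 h2].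
  have /andP[f1 f2] : - `|f 0| <= f 0 <= `|f 0| by rewrite -ler_norml.
  rewrite ler_norml; apply/andP; split; lra.
Qed.

Definition flat_gap n w : R :=
  sqn (grad f (mean (x n w))) + L ^+ 2 / m%:R * sqn (dev (x n w)).

Lemma flat_gap_rintegrable n : (n <= N)%N -> rintegrable P (flat_gap n).
Proof.
move=> nN; have [sx _ _] := iterates_sqint nN.
apply: rintegrableD; first exact: msqint_sqn (grad_mean_sqint nN).
by apply: rintegrableZ; apply: msqint_sqn; exact: msqint_dev.
Qed.

Lemma flat_potential_rintegrable lam n : (n <= N)%N ->
  rintegrable P (fun w => flat_potential fi K lam eta (x^~ w) (y^~ w) n).
Proof.
move=> nN; have [sx _ sy] := iterates_sqint nN.
apply: rintegrableD; first exact: mean_fun_rintegrable.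
apply: rintegrableZ; apply: rintegrableD; first by apply: msqint_sqn; exact: msqint_dev.
by apply: rintegrableZ; apply: msqint_sqn; exact: msqint_dev.
Qed.

Lemma round_index S s k : N = (S * K)%N -> (s < S)%N -> (k <= K)%N -> (s * K + k <= N)%N.
Proof.
move=> -> sS kK; apply: (@leq_trans (s.+1 * K)); last by rewrite leq_mul2r sS orbT.
by rewrite mulSn addnC leq_add2r.
Qed.

Let noise n0 w : R := round_noise fi K (x^~ w) (g^~ w) n0.

(** Each squared error matrix has expectation at most m sigma^2, and 3(K + 1) + 3K <= 9K. *)
Lemma round_noise_bound S s : N = (S * K)%N -> (s < S)%N -> (0 < K)%N ->
  rintegrable P (noise (s * K)) /\ Ex P (noise (s * K)) <= 9 * K%:R * (m%:R * sigma ^+ 2).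
Proof.
move=> NE sS K0.
have ix k : (k <= K)%N -> rintegrable P (fun w => sqn (xi (s * K + k) w)).
  by move=> kK; apply: msqint_sqn; apply: xi_sqint; exact: round_index sS kK.
have bx k : (k <= K)%N -> Ex P (fun w => sqn (xi (s * K + k) w)) <= m%:R * sigma ^+ 2.
  by move=> kK; apply: Ex_xi_total; exact: round_index sS kK.
have i0 : rintegrable P (fun w => sqn (xi (s * K) w)) by have := ix 0 (leq0n _); rewrite addn0.
have b0 : Ex P (fun w => sqn (xi (s * K) w)) <= m%:R * sigma ^+ 2.
  by have := bx 0 (leq0n _); rewrite addn0.
have iK := ix K (leqnn K); have bK := bx K (leqnn K).
have iS : rintegrable P (fun w => \sum_(k < K.+1) sqn (xi (s * K + k) w)).
  by apply: rintegrable_sum => k; apply: ix; rewrite -ltnS.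
have nE : noise (s * K) = (fun w => 3 * (\sum_(k < K.+1) sqn (xi (s * K + k) w)) +
   K%:R * (2 * sqn (xi (s * K) w) + sqn (xi (s * K + K) w))) by [].
have i2 : rintegrable P (fun w => 2 * sqn (xi (s * K) w) + sqn (xi (s * K + K) w)).
  by apply: rintegrableD => //; exact: rintegrableZ.
have i3 := rintegrableZ 3 iS; have i4 := rintegrableZ K%:R i2; have i5 := rintegrableZ 2 i0.
rewrite nE; split; first exact: rintegrableD.
rewrite ExD // !ExZ // ExD // ExZ // Ex_sum; last by move=> k; apply: ix; rewrite -ltnS.
have bS : \sum_(k < K.+1) Ex P (fun w => sqn (xi (s * K + k) w)) <= K.+1%:R * (m%:R * sigma ^+ 2).
  apply: (@le_trans _ _ (\sum_(k < K.+1) m%:R * sigma ^+ 2)).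
    by apply: ler_sum => k _; apply: bx; rewrite -ltnS.
  by rewrite sumr_const card_ord [leRHS]mulr_natl.
have K1 : 1 <= K%:R :> R by rewrite ler1n.
have v0 : 0 <= m%:R * sigma ^+ 2 by rewrite mulr_ge0 ?ler0n ?sqr_ge0.
have K1v := ler_wpM2r v0 K1.
have h2 : K%:R * (2 * Ex P (fun w => sqn (xi (s * K) w)) + Ex P (fun w => sqn (xi (s * K + K) w)))
   <= K%:R * (3 * (m%:R * sigma ^+ 2)).
  apply: ler_wpM2l; first exact: ler0n.
  exact (two_plus_one_le b0 bK).
rewrite -natr1 in bS; exact (round_noise_arith K1v bS h2).
Qed.

(** The coefficient of sigma^2 collects L eta^2/m from each of the S K steps, and 270 = 30 times 9
    from the round noise. *)
Lemma flat_expectation S lam : N = (S * K)%N -> (0 < K)%N -> 0 <= lam < 1 ->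
  (forall j, \sum_i W i j = 1) -> (forall i, \sum_j W i j = 1) ->
  (forall B : 'M[R]_(m, p), sqn (W *m dev B) <= lam ^+ 2 * sqn (dev B)) ->
  0 < eta -> eta <= 1 -> L * eta <= 1 / 4 ->
  576 * (eta ^+ 2 * K%:R ^+ 2 * L ^+ 2) <= (1 - lam) ^+ 4 ->
  6 * eta * L ^+ 2 * K%:R ^+ 2 * m%:R <= 1 - lam ->
  eta / 2 * (\sum_(s < S) \sum_(k < K) Ex P (flat_gap (s * K + k)))
  <= Ex P (fun w => flat_potential fi K lam eta (x^~ w) (y^~ w) 0 -
                    flat_potential fi K lam eta (x^~ w) (y^~ w) N)
   + eta ^+ 2 * ((S * K)%:R / m%:R) * (L + 270 / (1 - lam) ^+ 3) * sigma ^+ 2.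
Proof.
move=> NE K0 lam01 Wc Wr Wk eta0 eta1 etaL etaE etaX.
have mR : 0 < m%:R :> R by rewrite ltr0n.
have mu0 : 0 < 1 - lam by rewrite subr_gt0; case/andP: lam01.
(* The inequality is applied at each outcome separately, so expectations are taken only of its final
   form. *)
have path w := @flat_progress R m p fi L m0 L0 fi_diff local_loss_lip K S W lam eta
  (x^~ w) (y^~ w) (g^~ w) K0 lam01 Wc Wr Wk
  (fun n nS => flat_x flat w (leq_trans nS (eq_leq (esym NE))))
  (fun n nS => flat_y flat w (leq_trans nS (eq_leq (esym NE))))
  (congr1 (fun B : 'M[R]_(m, p) => mean B) (flat_y0 flat w)) eta0 eta1 etaL etaE etaX.
have iN s k : (s < S)%N -> (k < K)%N -> (s * K + k <= N)%N.
  by move=> sS kK; exact: (round_index NE sS (ltnW kK)).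
have ig (s : 'I_S) (k : 'I_K) : rintegrable P (flat_gap (s * K + k)).
  by apply: flat_gap_rintegrable; exact: iN.
pose e n w := edot (grad f (mean (x n w))) (mean (xi n w)).
pose q n w := sqn (mean (xi n w)).
have ie (s : 'I_S) (k : 'I_K) : rintegrable P (e (s * K + k)%N).
  by apply: msqint_edot; [apply: grad_mean_sqint | apply: msqint_mean; apply: xi_sqint]; exact: iN.
have iq (s : 'I_S) (k : 'I_K) : rintegrable P (q (s * K + k)%N).
  by apply: msqint_sqn; apply: msqint_mean; apply: xi_sqint; exact: iN.
have iP0 := flat_potential_rintegrable lam (leq0n N).
have iPN := flat_potential_rintegrable lam (leqnn N).
have iPP := rintegrableB iP0 iPN.
have inz (s : 'I_S) : rintegrable P (noise (s * K)).
  by have [] := round_noise_bound NE (ltn_ord s) K0.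
pose G w := \sum_(s < S) \sum_(k < K) flat_gap (s * K + k) w.
pose M w := \sum_(s < S) \sum_(k < K) (- eta * e (s * K + k)%N w + L * eta ^+ 2 * q (s * K + k)%N w).
pose Q w := \sum_(s < S) noise (s * K) w.
have ieq (s : 'I_S) (k : 'I_K) :
    rintegrable P (fun w => - eta * e (s * K + k)%N w + L * eta ^+ 2 * q (s * K + k)%N w).
  by apply: rintegrableD; exact: rintegrableZ.
have iG : rintegrable P G by apply: rintegrable_sum => s; exact: rintegrable_sum.
have iM : rintegrable P M by apply: rintegrable_sum => s; exact: rintegrable_sum.
have iQ : rintegrable P Q by apply: rintegrable_sum.
set c := 30 * eta ^+ 2 / ((1 - lam) ^+ 3 * m%:R ^+ 2).
have c0 : 0 <= c by rewrite /c divr_ge0 // ?mulr_ge0 ?exprn_ge0 ?ltW.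
have pathE w : eta / 2 * G w <= (flat_potential fi K lam eta (x^~ w) (y^~ w) 0 -
      flat_potential fi K lam eta (x^~ w) (y^~ w) N) + M w + c * Q w.
  by rewrite NE; exact: path w.
have iPM := rintegrableD iPP iM.
have icQ := rintegrableZ c iQ.
have := Ex_le (rintegrableZ (eta / 2) iG) (rintegrableD iPM icQ) pathE.
rewrite ExZ // ExD // ExD // ExZ //.
have -> : Ex P G = \sum_(s < S) \sum_(k < K) Ex P (flat_gap (s * K + k)).
  rewrite Ex_sum; last by move=> s; exact: rintegrable_sum.
  by apply: eq_bigr => s _; rewrite Ex_sum.
move=> /le_trans; apply; rewrite -addrA lerD2l.
have hM : Ex P M <= eta ^+ 2 * ((S * K)%:R / m%:R) * L * sigma ^+ 2.
  rewrite Ex_sum; last by move=> s; exact: rintegrable_sum.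
  have -> : eta ^+ 2 * ((S * K)%:R / m%:R) * L * sigma ^+ 2 =
      \sum_(s < S) \sum_(k < K) L * eta ^+ 2 * (sigma ^+ 2 / m%:R).
    by rewrite !sumr_const !card_ord -mulrnA mulnC -mulr_natl; ring.
  apply: ler_sum => s _; rewrite Ex_sum //; apply: ler_sum => k _.
  rewrite ExD ?ExZ //; try exact: rintegrableZ.
  have -> : Ex P (e (s * K + k)%N) = 0.
    apply: Ex_edot_xi; [exact: iN | apply: grad_mean_sqint; exact: iN |].
    by move=> i; apply: grad_mean_meas; exact: iN.
  rewrite mulr0 add0r ler_wpM2l ?Ex_xi_mean ?iN //.
  by rewrite mulr_ge0 ?sqr_ge0 ?ltW.
have hQ : Ex P Q <= S%:R * (9 * K%:R * (m%:R * sigma ^+ 2)).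
  rewrite Ex_sum //; apply: (@le_trans _ _ (\sum_(s < S) (9 * K%:R * (m%:R * sigma ^+ 2)))).
    by apply: ler_sum => s _; have [] := round_noise_bound NE (ltn_ord s) K0.
  by rewrite sumr_const card_ord [leRHS]mulr_natl.
apply: (le_trans (lerD hM (ler_wpM2l c0 hQ))).
rewrite le_eqVlt; apply/orP; left; apply/eqP; rewrite /c natrM.
by field; rewrite !gt_eqF.
Qed.
End FlatExpectation.

(** * Flattening the two round indices and the final bound *)

Lemma mutually_independent_reindex (R : realType) (d d' : measure_display)
    (T : measurableType d) (Z : measurableType d') (P : probability T R)
    (I I' : choiceType) (A : set I) (A' : set I') (X : I' -> T -> Z)
    (h : I -> I') (h' : I' -> I) :
  cancel h h' -> (forall t, A t -> A' (h t)) ->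
  mutually_independent P A' X -> mutually_independent P A (fun t => X (h t)).
Proof.
move=> hK hA ind J B JA mB.
have := ind [fset h t | t in J]%fset (fun t => B (h' t)).
rewrite big_imfset /=; last by move=> s t _ _; exact: (can_inj hK).
have -> : (\prod_(i <- J) P (X (h i) @^-1` B (h' (h i))) =
    \prod_(i <- J) P (X (h i) @^-1` B i))%E by apply: eq_bigr => i _; rewrite hK.
move=> <- //; last first.
  by move=> _ /= /imfsetP[t /= tJ ->]; apply: hA; exact: JA.
congr (P _); apply/seteqP; split => w /= H t /=.
  by move=> /imfsetP[s /= sJ ->]; rewrite hK; exact: H.
move=> tJ; have := H (h t); rewrite /= hK; apply.
by apply/imfsetP; exists t.
Qed.

Section Flatten.
Variables (K : nat).
Hypothesis K0 : (0 < K)%N.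

(** At a multiple n = (s+1) K the sample in use is the one drawn at (s, K). Local sample indices
    therefore run over 1..K, with n = 0 apart, whereas [flatten] below uses 0..K-1. *)
Definition sample_round n := (n.-1 %/ K)%N.
Definition sample_local n := if n is n'.+1 then (n' %% K).+1 else 0%N.

Lemma sample_indexK n :
  (if sample_local n == 0 then 0 else sample_round n * K + sample_local n)%N = n.
Proof. by case: n => [|n] //=; rewrite addnS -divn_eq. Qed.

Lemma sample_drawn S n : (n <= S * K)%N -> drawn S K (sample_round n) (sample_local n).
Proof.
case: n => [|n] nS; first by rewrite /drawn /sample_round /= div0n.
by rewrite /drawn /sample_round /= ltn_divLR // nS /= ltn_pmod // orbT.
Qed.

Definition flatten (V : Type) (a : nat -> nat -> V) n := a (n %/ K)%N (n %% K)%N.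

Lemma flattenE (V : Type) (a : nat -> nat -> V) s k : (k < K)%N ->
  flatten a (s * K + k) = a s k.
Proof. by move=> kK; rewrite /flatten divnMDl // modnMDl divn_small // addn0 modn_small. Qed.

(** At the end of a round [flatten] already reads (s + 1, 0); the hypothesis identifies it with (s,
    K), so the successor formula has no boundary case. *)
Lemma flattenS (V : Type) (a : nat -> nat -> V) S n :
  (forall s, (s < S)%N -> a s.+1 0 = a s K) -> (n < S * K)%N ->
  flatten a n.+1 = a (n %/ K)%N (n %% K).+1.
Proof.
move=> next nS; have sS : (n %/ K < S)%N by rewrite ltn_divLR.
have kK : (n %% K < K)%N by rewrite ltn_pmod.
rewrite {1}(divn_eq n K) -addnS.
have [k1|k1] := ltnP (n %% K).+1 K; first by rewrite flattenE.
have -> : (n %% K).+1 = K by apply/eqP; rewrite eqn_leq kK.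
by rewrite -next // -mulSnr -[(_ * K)%N]addn0 flattenE.
Qed.
End Flatten.

Section Netfleet.
Context (R : realType) (m p : nat) (T Z : Type).
Variables (F : 'I_m -> 'rV[R]_p -> Z -> R) (W : 'M[R]_m) (x0 : 'rV[R]_p) (eta : R)
  (S K : nat) (zeta : 'I_m -> nat -> nat -> T -> Z)
  (x y g : nat -> nat -> 'I_m -> T -> 'rV[R]_p).

Definition stack (v : nat -> nat -> 'I_m -> T -> 'rV[R]_p) n w : 'M[R]_(m, p) :=
  \matrix_i flatten K v n i w.

Lemma stack_mulmx v n w :
  W *m stack v n w = \matrix_i \sum_j W i j *: flatten K v n j w.
Proof.
apply/row_matrixP => i; rewrite rowK row_mul mulmx_sum_row; apply: eq_bigr => j _.
by rewrite mxE rowK.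
Qed.

Lemma netfleet_flat : (0 < K)%N -> netfleet_iterates F W x0 eta S K zeta x y g ->
  flat_iterates K (S * K) F W x0 eta
    (fun i n => zeta i (sample_round K n) (sample_local K n)) (stack x) (stack y) (stack g).
Proof.
move=> K0 nf.
have xN s : (s < S)%N -> x s.+1 0 = x s K.
  by move=> sS; apply/funext => i; apply/funext => w; exact: (nf_x_next nf).
have yN s : (s < S)%N -> y s.+1 0 = y s K.
  by move=> sS; apply/funext => i; apply/funext => w; exact: (nf_y_next nf).
have gN s : (s < S)%N -> g s.+1 0 = g s K.
  by move=> sS; apply/funext => i; apply/funext => w; exact: (nf_g_next nf).
have n0 v : flatten K v 0 = v 0 0 :> ('I_m -> T -> 'rV[R]_p) by rewrite /flatten div0n mod0n.
have lt1 n : (n < S * K)%N -> (n %/ K < S)%N by rewrite ltn_divLR.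
have lt2 n : (n %% K < K)%N by rewrite ltn_pmod.
split.
- by move=> w; apply/row_matrixP => i; rewrite !rowK n0 (nf_x_init nf).
- by move=> w; apply/row_matrixP => i; rewrite !rowK !n0 (nf_y_init nf).
- move=> [|n] w nS; apply/row_matrixP => i; rewrite !rowK.
    by rewrite !n0 (nf_g_init nf) /sample_round div0n.
  (* Step n + 1 is now read at the very indices given by [sample_round] and [sample_local]. *)
  rewrite (flattenS K0 gN nS) (flattenS K0 xN nS) (nf_g nf) ?lt1 //=.
- move=> n w nS; apply/row_matrixP => i; rewrite rowK (flattenS K0 xN nS).
  rewrite linearB linearZ /= rowK stack_mulmx.
  case: (posnP (n %% K)%N) => [n0'|n1].
    have -> : (K %| n)%N by rewrite /dvdn n0'.
    by rewrite n0' rowK (nf_x_mix nf) ?lt1 // /flatten n0'.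
  have -> : (K %| n)%N = false by rewrite /dvdn eqn0Ngt n1.
  by rewrite rowK (nf_x_local nf) ?lt1 ?n1 ?lt2.
- move=> n w nS; apply/row_matrixP => i; rewrite rowK (flattenS K0 yN nS).
  rewrite linearB linearD /= !rowK stack_mulmx (flattenS K0 gN nS).
  case: (posnP (n %% K)%N) => [n0'|n1].
    have -> : (K %| n)%N by rewrite /dvdn n0'.
    by rewrite n0' rowK (nf_y_mix nf) ?lt1 // /flatten n0'.
  have -> : (K %| n)%N = false by rewrite /dvdn eqn0Ngt n1.
  by rewrite rowK (nf_y_local nf) ?lt1 ?n1 ?lt2.
Qed.

Lemma avg_stack v n w : avg (fun i => flatten K v n i w) = mean (stack v n w).
Proof. by rewrite /avg /mean; congr (_ *: _); apply: eq_bigr => i _; rewrite rowK. Qed.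

Lemma sum_enorm_stack v n w (b : 'rV[R]_p) : b = mean (stack v n w) ->
  \sum_i enorm (flatten K v n i w - b) ^+ 2 = sqn (dev (stack v n w)).
Proof.
move=> ->; rewrite sqn_rows; apply: eq_bigr => i _.
by rewrite enorm_sqr /dev linearB /= !rowK.
Qed.
End Netfleet.

(** * The constants and the final rate *)

Section Constants.
Variables (R : realType) (L mu : R).
Hypothesis L0 : 0 < L.
Hypothesis mu01 : 0 < mu <= 1.

(** A generous choice: (1 + L)^2 dominates L and L^2, mu^4 every power of mu required, and 1000 the
    numerical factors. *)
Definition step_const : R := mu ^+ 4 / (1000 * (1 + L) ^+ 2).

(** These are the conditions of [flat_expectation] after inserting eta = c/(m K^2); the last bounds
    the coefficient of sigma^2 by 1. *)
Lemma step_const_bounds :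
  [/\ 0 < step_const, step_const <= 1, step_const * L <= 1 / 4 &
   [/\ 576 * (step_const ^+ 2 * L ^+ 2) <= mu ^+ 4, 6 * step_const * L ^+ 2 <= mu &
       step_const ^+ 2 * (L + 270 / mu ^+ 3) <= 1]].
Proof.
have /andP[mu0 mu1] := mu01.
have L1 : 0 < 1 + L by rewrite addr_gt0.
pose a := (1 + L)^-1.
have a0 : 0 < a by rewrite invr_gt0.
have aL : a * L <= 1 by rewrite /a ler_pdivrMl // mulr1 lerDr.
have a1 : a <= 1 by rewrite /a invf_le1 // lerDl ltW.
have mu4 : mu ^+ 4 <= mu by rewrite -[leRHS]expr1 ler_wiXn2l // ltW.
have m40 : 0 < mu ^+ 4 by rewrite exprn_gt0.
have cE : step_const = mu ^+ 4 * a ^+ 2 / 1000.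
  by rewrite /step_const /a; field; rewrite gt_eqF.
have aL0 : 0 <= a * L by rewrite mulr_ge0 // ltW.
have a2 : a ^+ 2 <= 1 by rewrite exprn_ile1 ?(ltW a0).
have a2L : a ^+ 2 * L <= 1 by rewrite expr2 -mulrA mulr_ile1 ?(ltW a0).
have a2L2 : a ^+ 2 * L ^+ 2 <= 1 by rewrite -exprMn exprn_ile1.
have a20 : 0 < a ^+ 2 by rewrite exprn_gt0.
have t0 : 0 < (1000 : R)^-1 by rewrite invr_gt0 ltr0n.
have c0 : 0 < step_const by rewrite cE; apply: mulr_gt0 t0; exact: mulr_gt0.
have m1k : 0 <= mu ^+ 4 / 1000 by apply: mulr_ge0; exact: ltW.
have c1 : step_const <= mu ^+ 4 / 1000.
  by rewrite cE; apply: (ler_wpM2r (ltW t0)); rewrite ler_piMr // ltW.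
have cL : step_const * L <= mu ^+ 4 / 1000.
  have -> : step_const * L = mu ^+ 4 / 1000 * (a ^+ 2 * L) by rewrite cE; ring.
  exact: (ler_piMr m1k a2L).
have cL0 : 0 <= step_const * L by rewrite mulr_ge0 // ltW.
have m41 := le_trans mu4 mu1.
split; [exact: c0 | lra | lra | split].
- rewrite -exprMn expr2.
  have : step_const * L * (step_const * L) <= mu ^+ 4 / 1000 * 1.
    apply: ler_pM; [exact: cL0 | exact: cL0 | exact: cL | lra].
  lra.
- have -> : 6 * step_const * L ^+ 2 = 6 / 1000 * mu ^+ 4 * (a ^+ 2 * L ^+ 2) by rewrite cE; ring.
  have : mu ^+ 4 * (a ^+ 2 * L ^+ 2) <= mu ^+ 4 by rewrite ler_piMr // ltW.
  lra.
- have e3 : step_const / mu ^+ 3 = mu * a ^+ 2 / 1000.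
    by rewrite cE; field; rewrite gt_eqF.
  have -> : step_const ^+ 2 * (L + 270 / mu ^+ 3) =
    step_const * (step_const * L) + 270 * (step_const * (step_const / mu ^+ 3)).
    by ring.
  have h1 : step_const * (step_const * L) <= 1 / 1000 * 1 by apply: ler_pM; lra.
  have h2 : step_const / mu ^+ 3 <= 1 / 1000.
    by rewrite e3; apply: (ler_wpM2r (ltW t0)); rewrite mulr_ile1 ?(ltW mu0) ?(ltW a20).
  have h3 : step_const * (step_const / mu ^+ 3) <= 1 / 1000 * (1 / 1000).
    by apply: ler_pM; [exact: ltW | rewrite divr_ge0 ?exprn_ge0 ?(ltW mu0) ?(ltW c0) | lra | ].
  lra.
Qed.
End Constants.

Lemma cube_rounds (R : realType) (m S K : nat) : (0 < m)%N ->
  K%:R = S%:R `^ (3%:R^-1) / m%:R :> R -> S%:R = (m%:R * K%:R) ^+ 3 :> R.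
Proof.
move=> m0 ->; rewrite mulrC divfK ?pnatr_eq0 -?lt0n //.
by rewrite -powR_mulrn ?powR_ge0 // -powRrM mulVf ?pnatr_eq0 // powRr1.
Qed.

Lemma step_size_values (R : realType) (c : R) (m S K : nat) : (0 < m)%N -> (0 < K)%N ->
  S%:R = (m%:R * K%:R) ^+ 3 :> R ->
  c * Num.sqrt (m%:R / (S * K)%:R) = c / (m%:R * K%:R ^+ 2) /\
  Num.sqrt (S * K * m)%:R = m%:R ^+ 2 * K%:R ^+ 2 :> R.
Proof.
move=> m0 K0 SE.
have mR : 0 < m%:R :> R by rewrite ltr0n.
have KR : 0 < K%:R :> R by rewrite ltr0n.
split.
  rewrite natrM SE; congr (_ * _).
  have -> : m%:R / ((m%:R * K%:R) ^+ 3 * K%:R) = ((m%:R * K%:R ^+ 2)^-1) ^+ 2 :> R.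
    by field; rewrite !gt_eqF.
  by rewrite sqrtr_sqr ger0_norm // invr_ge0 mulr_ge0 ?exprn_ge0 ?ltW.
rewrite !natrM SE.
have -> : (m%:R * K%:R) ^+ 3 * K%:R * m%:R = (m%:R ^+ 2 * K%:R ^+ 2) ^+ 2 :> R by ring.
by rewrite sqrtr_sqr ger0_norm // mulr_ge0 ?exprn_ge0 ?ltW.
Qed.

(** Here eta S K = c m^2 K^2 and eta^2 S K/m = c^2: dividing by eta S K/2 gives the rate with the
    constant 2/c. *)
Lemma final_rate_arith (R : realFieldType) (G E v c eta M k SK b : R) :
  0 < M -> 0 < k -> 0 < c -> 0 <= v -> eta = c / (M * k ^+ 2) ->
  SK = M ^+ 3 * k ^+ 4 -> c ^+ 2 * b <= 1 ->
  eta / 2 * G <= E + eta ^+ 2 * (SK / M) * b * v ->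
  SK^-1 * G <= 2 / c * (E * (M ^+ 2 * k ^+ 2)^-1 + v / (M ^+ 2 * k ^+ 2)).
Proof.
move=> M0 k0 c0 v0 -> -> cb h.
have -> : (M ^+ 3 * k ^+ 4)^-1 * G =
    2 / c * (M ^+ 2 * k ^+ 2)^-1 * (c / (M * k ^+ 2) / 2 * G).
  by field; rewrite !gt_eqF.
have a0 : 0 <= 2 / c * (M ^+ 2 * k ^+ 2)^-1.
  by apply: mulr_ge0; [apply: divr_ge0 => //; exact: ltW | rewrite invr_ge0 mulr_ge0 ?exprn_ge0 ?ltW].
apply: (le_trans (ler_wpM2l a0 h)).
have -> : 2 / c * (E * (M ^+ 2 * k ^+ 2)^-1 + v / (M ^+ 2 * k ^+ 2)) =
    2 / c * (M ^+ 2 * k ^+ 2)^-1 * (E + v) by ring.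
apply: ler_wpM2l => //; rewrite lerD2l.
have -> : (c / (M * k ^+ 2)) ^+ 2 * (M ^+ 3 * k ^+ 4 / M) * b * v = c ^+ 2 * b * v.
  by field; rewrite !gt_eqF.
by rewrite ler_piMl.
Qed.

Theorem corollary2 (R : realType) (L lam : R) (hL : 0 < L) :
  exists c C : R, 0 < c /\ 0 < C /\
  forall (m p S K : nat) (sigma eta : R)
    (e : rel 'I_m) (W : 'M[R]_m) (eigs : seq R)
    (dZ : measure_display) (Z : measurableType dZ)
    (D : 'I_m -> probability Z R) (F : 'I_m -> 'rV[R]_p -> Z -> R)
    (dT : measure_display) (T : measurableType dT) (P : probability T R)
    (zeta : 'I_m -> nat -> nat -> {RV P >-> Z})
    (x0 : 'rV[R]_p) (x y g : nat -> nat -> 'I_m -> T -> 'rV[R]_p),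
    (1 < m)%N ->
    connected_graph e ->
    consensus_matrix e W ->
    ordered_eigenvalues W eigs ->
    eigs`_0 = 1 -> eigs`_1 < 1 -> -1 < eigs`_m.-1 ->
    lam = Num.max `|eigs`_1| `|eigs`_m.-1| ->
    0 < sigma ->
    stochastic_problem D F L sigma ->
    netfleet_samples P D S K zeta ->
    netfleet_iterates F W x0 eta S K zeta x y g ->
    (0 < K)%N ->
    K%:R = S%:R `^ (3%:R^-1) / m%:R :> R ->
    m%:R `^ (3%:R^-1) <= (S * K)%:R :> R ->
    eta = c * Num.sqrt (m%:R / (S * K)%:R) ->
    ((((S * K)%:R^-1)%:E *
       \sum_(s < S) \sum_(k < K)
         'E_P[(fun w => stationarity_gap (global_loss D F) L
                          (fun i => x s k i w))%R])
     <= C%:E *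
        ('E_P[(fun w =>
            potential (global_loss D F) lam eta K
              (fun i => x 0%N 0%N i w) (fun i => y 0%N 0%N i w)
          - potential (global_loss D F) lam eta K
              (fun i => x S 0%N i w) (fun i => y S 0%N i w))%R]
           * ((Num.sqrt (S * K * m)%:R)^-1)%:E
         + (sigma ^+ 2 / Num.sqrt (S * K * m)%:R)%:E))%E.
Proof.
(* The constants are chosen before any matrix is given. A [lam] outside [0, 1) is realised by no
   consensus matrix, so any constants will do. *)
have [lam01|lamN] := boolP (0 <= lam < 1); last first.
  exists 1, 1; do 2!split => //.
  move=> m p S K sigma eta e W eigs dZ Z D F dT T P zeta x0 x y g m1 _ cW oe e0 e1 em lamE.
  have [l0 l1 _] := consensus_contraction (0 : 'M[R]_(m, p)) m1 cW oe e0 e1 em lamE.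
  by rewrite l0 l1 in lamN.
have mu01 : 0 < 1 - lam <= 1.
  by rewrite subr_gt0 lerBlDr lerDl andbC.
pose c := step_const L (1 - lam).
have [c0 c1 cL [cE cX cN]] := step_const_bounds hL mu01; rewrite -/c in c0 c1 cL cE cX cN.
exists c, (2 / c); split => //; split; first by rewrite divr_gt0.
move=> m p S K sigma eta e W eigs dZ Z D F dT T P zeta x0 x y g m1 _ cW oe e0 e1 em lamE
  sigma0 problem [zlaw zind] nf K0 KE _ etaE.
have m0 : (0 < m)%N by exact: ltnW.
have mR : 1 <= m%:R :> R by rewrite ler1n.
have KR : 1 <= K%:R :> R by rewrite ler1n.
have mR0 : 0 < m%:R :> R by rewrite ltr0n.
have KR0 : 0 < K%:R :> R by rewrite ltr0n.
have SE := cube_rounds m0 KE.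
have [ev sq] := step_size_values c m0 K0 SE.
rewrite {}ev in etaE; rewrite sq.
have mk1 : 1 <= m%:R * K%:R ^+ 2 :> R by rewrite mulr_ege1 ?exprn_ege1.
have mk0 : 0 < m%:R * K%:R ^+ 2 :> R by rewrite mulr_gt0 ?exprn_gt0.
have eta0 : 0 < eta by rewrite etaE divr_gt0.
have etac : eta <= c by rewrite etaE ler_pdivrMr // ler_peMr // ltW.
have eta1 : eta <= 1 by exact: le_trans etac c1.
have etaL : L * eta <= 1 / 4.
  by apply: le_trans cL; rewrite mulrC ler_wpM2r // ltW.
(* eta K = c/(m K) is at most c. *)
have eta_ep : 576 * (eta ^+ 2 * K%:R ^+ 2 * L ^+ 2) <= (1 - lam) ^+ 4.
  apply: le_trans cE; rewrite ler_wpM2l ?ler0n // ler_wpM2r ?sqr_ge0 // -exprMn.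
  have ek0 : 0 <= eta * K%:R by rewrite mulr_ge0 ?ltW.
  rewrite lerXn2r ?nnegrE ?(ltW c0) // etaE.
  have -> : c / (m%:R * K%:R ^+ 2) * K%:R = c / (m%:R * K%:R).
    by field; rewrite !gt_eqF.
  by rewrite ler_pdivrMr ?mulr_gt0 // ler_peMr ?(ltW c0) // mulr_ege1.
(* The factor m K^2 cancels exactly, leaving 6 c L^2. *)
have eta_X : 6 * eta * L ^+ 2 * K%:R ^+ 2 * m%:R <= 1 - lam.
  apply: le_trans cX; rewrite etaE le_eqVlt; apply/orP; left; apply/eqP.
  by field; rewrite !gt_eqF.
pose h (t : 'I_m * nat) := (t.1, sample_round K t.2, sample_local K t.2).
(* The inverse on sample indices must send (0, 0) to 0 separately, since local index 0 occurs only
   for the initial sample. *)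
pose h' (t : 'I_m * nat * nat) := (t.1.1, (if t.2 == 0 then 0 else t.1.2 * K + t.2)%N).
have hK : cancel h h' by move=> [i n]; rewrite /h /h' /= sample_indexK.
pose zf i n : {mfun T >-> Z} := zeta i (sample_round K n) (sample_local K n).
have zf_law i n : (n <= S * K)%N -> forall B, measurable B -> P (zf i n @^-1` B) = D i B.
  by move=> nS B mB; rewrite -(zlaw i _ _ (sample_drawn K0 nS) B mB).
have zf_ind : mutually_independent P [set t : 'I_m * nat | (t.2 <= S * K)%N]
    (fun t => zf t.1 t.2 : T -> Z).
  apply: (mutually_independent_reindex hK _ zind) => -[i n] /=.
  exact: sample_drawn.
have flat := netfleet_flat K0 nf.
have Wk (B : 'M[R]_(m, p)) : sqn (W *m dev B) <= lam ^+ 2 * sqn (dev B).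
  by have [] := consensus_contraction B m1 cW oe e0 e1 em lamE.
have main := flat_expectation m0 problem zf_law zf_ind flat hL erefl K0 lam01
  (cmx_col_sum cW) (cmx_row_sum cW) Wk eta0 eta1 etaL eta_ep eta_X.
have gapE s k : (k < K)%N ->
    (fun w => stationarity_gap (global_loss D F) L (fun i => x s k i w)) =
    flat_gap D F L (stack K x) (s * K + k).
  move=> kK; apply/funext => w.
  have -> : (fun i => x s k i w) = (fun i => flatten K x (s * K + k) i w).
    by apply/funext => i; rewrite flattenE.
  rewrite /stationarity_gap /flat_gap avg_stack enorm_sqr; cbv beta; rewrite (sum_enorm_stack erefl).
  by congr (sqn (grad _ _) + _).
have potE s : (fun w => potential (global_loss D F) lam eta K (x s 0 ^~ w) (y s 0 ^~ w)) =
    (fun w => flat_potential (local_loss D F) K lam eta (stack K x ^~ w) (stack K y ^~ w) (s * K)).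
  apply/funext => w.
  have fE v : (fun i => v s 0%N i w) = (fun i => flatten K v (s * K) i w) :> ('I_m -> 'rV[R]_p).
    by apply/funext => i; rewrite -[(s * K)%N]addn0 flattenE.
  rewrite !fE /potential /flat_potential !avg_stack; cbv beta; rewrite big_split -mulr_sumr.
  by rewrite !(sum_enorm_stack erefl).
have gapEx (s : 'I_S) (k : 'I_K) :
    ('E_P[(fun w => stationarity_gap (global_loss D F) L (fun i => x s k i w))])%E =
    (Ex P (flat_gap D F L (stack K x) (s * K + k)))%:E.
  rewrite gapE // unlock EFin_Ex //.
  apply: (flat_gap_rintegrable problem zf_law zf_ind flat).
  exact: (round_index erefl (ltn_ord s) (ltnW (ltn_ord k))).
have potEx : ('E_P[(fun w => potential (global_loss D F) lam eta K
        (fun i => x 0%N 0%N i w) (fun i => y 0%N 0%N i w)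
      - potential (global_loss D F) lam eta K
        (fun i => x S 0%N i w) (fun i => y S 0%N i w))%R])%E =
    (Ex P (fun w => flat_potential (local_loss D F) K lam eta (stack K x ^~ w) (stack K y ^~ w) 0 -
      flat_potential (local_loss D F) K lam eta (stack K x ^~ w) (stack K y ^~ w) (S * K)))%:E.
  have ip n (nS : (n <= S * K)%N) :=
    flat_potential_rintegrable m0 problem zf_law zf_ind flat hL lam nS.
  rewrite -(EFin_Ex (rintegrableB (ip 0 (leq0n _)) (ip (S * K)%N (leqnn _)))) unlock.
  have pE s w := congr1 (fun u : T -> R => u w) (potE s).
  have p0 w := pE 0%N w; rewrite mul0n in p0.
  by congr integral; apply/funext => w; congr (_ - _)%:E; [exact: p0 | exact: pE].
rewrite potEx.
under eq_bigr do under eq_bigr do rewrite gapEx.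
under eq_bigr do rewrite sumEFin.
rewrite sumEFin -!EFinM lee_fin.
apply: (final_rate_arith mR0 KR0 c0 (sqr_ge0 sigma) etaE _ cN main).
by rewrite natrM SE; ring.
Qed.
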